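(* Let $K$ be a small definably closed subset of $\mathfrak{C}$ contained in some $M\preceq\mathfrak{C}$. Then the sorted complete system $S\mathcal{G}(K)$ is interpretable without parameters in the $\mathcal{L}_P$-structure $(M,K)$.
   Context: Setting. $T$ is a complete, possibly many-sorted, $\mathcal{L}$-theory with set of sorts $\mathcal{J}$; $T$ has quantifier elimination and uniform elimination of imaginaries ($T$ arises from an arbitrary theory by adding imaginary sorts and Morleyizing). $\mathfrak{C}\models T$ is a monster model; small means of cardinality smaller than the saturation of $\mathfrak{C}$; $\operatorname{acl},\operatorname{dcl}$ are computed in $\mathfrak{C}$. $\mathcal{L}_P=\mathcal{L}\cup\{P\}$, where $P$ is a new predicate (on each sort); $(M,K)$ is the $\mathcal{L}_P$-structure with universe $M$ in which $P$ is interpreted as $K$. Absolute Galois group: $\mathcal{G}(K)=\operatorname{Aut}(\operatorname{acl}(K)/\operatorname{dcl}(K))$, a profinite group. For an open normal subgroup $N$ of $\mathcal{G}(K)$ let $L=\operatorname{acl}(K)^N$ be its fixed set and $\mathcal{G}(L/K)=\operatorname{Aut}(L/K)$ (a finite group). For a finite tuple $J=(S_1,\dots,S_n)\in\mathcal{J}^{<\omega}$ of sorts put $S_J=S_1\times\cdots\times S_n$, let $\operatorname{Aut}_J(L/K)$ be the image of the restriction map $\mathcal{G}(L/K)\to\operatorname{Aut}(S_J(L)/S_J(K))$, and let $\mathcal{F}_K(N)=\{J\in\mathcal{J}^{<\omega} : |\operatorname{Aut}_J(L/K)|=|\mathcal{G}(L/K)|\}$. The sorted complete system $S\mathcal{G}(K)$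 is the following many-sorted structure in the language $\mathcal{L}_G(\mathcal{J})$ with sorts $m(k,J)$ ($0<k<\omega$, $J\in\mathcal{J}^{<\omega}$; distinct sorts are regarded as disjoint), binary relations $\leqslant$ and $C$ between any two sorts, and a ternary relation $P$ on each sort: $m(k,J)=\{gN : g\in\mathcal{G}(K),\ N \text{ open normal in } \mathcal{G}(K),\ [\mathcal{G}(K):N]\leqslant k,\ J\in\mathcal{F}_K(N)\}$; $gN\leqslant g'N'$ iff $N\subseteq N'$; $C(gN,g'N')$ iff $N\subseteq N'$ and $gN'=g'N'$; and on each sort $P(g_1N_1,g_2N_2,g_3N_3)$ iff $N_1=N_2=N_3$ and $g_1g_2N_1=g_3N_1$. Interpretable (for a many-sorted structure) means that each sort is in bijection with a definable set of imaginaries of $(M,K)$ so that every basic relation becomes definable. *)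

(* Defs.v *)
From HB Require Import structures.
From mathcomp Require Import all_boot.
From mathcomp Require Import mathcomp_extra boolp classical_sets functions.
From mathcomp Require Import cardinality topology.

Set Implicit Arguments.
Unset Strict Implicit.
Unset Printing Implicit Defensive.

Local Open Scope classical_set_scope.
Local Open Scope card_scope.

(** * Tuples over a list of sorts *)

Section Tuples.
Context {S : Type}.
Implicit Types (A B : S -> Type) (l : seq S).

Fixpoint tup A l : Type := if l is s :: l' then (A s * tup A l')%type else unit.

(* Positions of sort [s] in [l]; they serve as de Bruijn variables. *)
Inductive var : seq S -> S -> Type :=
| VZ s l : var (s :: l) s
| VS s s' l : var l s -> var (s' :: l) s.

Fixpoint tget A l s (x : var l s) : tup A l -> A s :=
  match x in var l s return tup A l -> A s with
  | VZ _ _ => fun v => v.1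
  | VS _ _ _ y => fun v => tget y v.2
  end.

Fixpoint ttab A l : (forall s, var l s -> A s) -> tup A l :=
  match l return (forall s, var l s -> A s) -> tup A l with
  | [::] => fun _ => tt
  | s :: l' => fun f => (f s (VZ s l'), ttab (fun s' y => f s' (VS s y)))
  end.

Fixpoint tmap A B (f : forall s, A s -> B s) l : tup A l -> tup B l :=
  match l return tup A l -> tup B l with
  | [::] => fun _ => tt
  | s :: l' => fun v => (f s v.1, tmap f v.2)
  end.

Fixpoint tcat A l1 l2 : tup A l1 -> tup A l2 -> tup A (l1 ++ l2) :=
  match l1 return tup A l1 -> tup A l2 -> tup A (l1 ++ l2) with
  | [::] => fun _ w => w
  | s :: l' => fun v w => (v.1, tcat v.2 w)
  end.

Fixpoint tall2 A B (P : forall s, A s -> B s -> Prop) l :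
    tup A l -> tup B l -> Prop :=
  match l return tup A l -> tup B l -> Prop with
  | [::] => fun _ _ => True
  | s :: l' => fun v w => P s v.1 w.1 /\ tall2 P v.2 w.2
  end.

End Tuples.

Fixpoint tflatten {S S' : Type} (A : S' -> Type) (ar : S -> seq S') (l : seq S) :
    tup (fun s => tup A (ar s)) l -> tup A (flatten (map ar l)) :=
  match l return
    tup (fun s => tup A (ar s)) l -> tup A (flatten (map ar l)) with
  | [::] => fun _ => tt
  | s :: l' => fun v => tcat v.1 (tflatten v.2)
  end.

(** * Many-sorted first-order logic *)

Record lang := Lang {
  lsort : Type;
  lfn : Type;
  fn_dom : lfn -> seq lsort;
  fn_cod : lfn -> lsort;
  lrel : Type;
  rel_ar : lrel -> seq lsort }.

Section Syntax.
Variable L : lang.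

Inductive term (G : seq (lsort L)) : lsort L -> Type :=
| Var s : var G s -> term G s
| App (f : lfn L) : (forall s, var (fn_dom f) s -> term G s) -> term G (fn_cod f).

Inductive formula (G : seq (lsort L)) : Type :=
| Bot : formula G
| Eq s : term G s -> term G s -> formula G
| Rel (R : lrel L) : tup (term G) (rel_ar R) -> formula G
| Imp : formula G -> formula G -> formula G
| All s : formula (s :: G) -> formula G.

Fixpoint quantifier_free G (phi : formula G) : Prop :=
  match phi with
  | Imp p q => quantifier_free p /\ quantifier_free q
  | All _ _ => False
  | _ => True
  end.

Definition sentence := formula [::].

End Syntax.
Arguments Bot {L G}.

(* Sorts are allowed to be empty; since formulas live in an explicit context,
   satisfaction is nevertheless well defined. *)
Record structure (L : lang) := Structure {
  carrier :> lsort L -> Type;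
  fint : forall f : lfn L, tup carrier (fn_dom f) -> carrier (fn_cod f);
  rint : forall R : lrel L, tup carrier (rel_ar R) -> Prop }.
Arguments fint {L} s f _.
Arguments rint {L} s R _.

Section Semantics.
Variables (L : lang) (N : structure L).

Fixpoint eval G s (t : term G s) (v : tup N G) : N s :=
  match t in term _ s return N s with
  | Var _ x => tget x v
  | App f ts => fint N f (ttab (fun s y => eval (ts s y) v))
  end.

Fixpoint sat G (phi : formula G) : tup N G -> Prop :=
  match phi with
  | Bot => fun _ => False
  | Eq _ t u => fun v => eval t v = eval u v
  | Rel R ts => fun v => rint N R (tmap (fun s t => eval t v) ts)
  | Imp p q => fun v => sat p v -> sat q v
  | All s p => fun v => forall a : N s, sat p ((a, v) : tup N (s :: _))
  end.

End Semantics.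
Arguments sat {L} N {G} phi _.

(** * Theories *)

Section Theories.
Variables (L : lang) (T : set (sentence L)).

Definition models (N : structure L) : Prop :=
  forall phi, T phi -> sat N phi tt.

Definition entails (phi : sentence L) : Prop :=
  forall N, models N -> sat N phi tt.

Definition complete_theory : Prop :=
  forall phi, entails phi \/ entails (Imp phi Bot).

Definition quantifier_elimination : Prop :=
  forall G (phi : formula G), exists2 psi : formula G, quantifier_free psi &
    forall N, models N -> forall v, sat N phi v <-> sat N psi v.

Definition uniform_elimination_of_imaginaries : Prop :=
  forall (J : seq (lsort L)) (eps : formula (J ++ J)),
    (forall N, models N ->
       RelationClasses.Equivalence (fun a b : tup N J => sat N eps (tcat a b))) ->
    exists (J' : seq (lsort L)) (chi : formula (J ++ J')),
      forall N, models N ->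
        (forall a, exists! c, sat N chi (tcat a c)) /\
        (forall a b, sat N eps (tcat a b) <->
           exists2 c, sat N chi (tcat a c) & sat N chi (tcat b c)).

End Theories.

(** * Subsets of a structure *)

Definition sset L (N : structure L) := forall s, set (N s).

Definition sub L (N : structure L) (A : sset N) (s : lsort L) : Type :=
  {x : N s | A s x}.

Definition inc L (N : structure L) (A : sset N) G (v : tup (sub A) G) : tup N G :=
  tmap (fun s (x : sub A s) => sval x) v.

Definition elementary_map L (N : structure L) (A : sset N)
    (f : forall s, sub A s -> N s) : Prop :=
  forall G (phi : formula G) (v : tup (sub A) G),
    sat N phi (inc v) <-> sat N phi (tmap f v).

Definition function_closed L (N : structure L) (A : sset N) : Prop :=
  forall (f : lfn L) (v : tup (sub A) (fn_dom f)), A _ (fint N f (inc v)).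

Definition substructure L (N : structure L) (A : sset N)
    (clA : function_closed A) : structure L :=
  @Structure L (sub A) (fun f v => exist _ (fint N f (inc v)) (clA f v))
    (fun R v => rint N R (inc v)).

Record elementary_substructure L (N : structure L) := ElementarySubstructure {
  esub_set : sset N;
  esub_closed : function_closed esub_set;
  esub_elem : forall G (phi : formula G) (v : tup (sub esub_set) G),
    sat (substructure esub_closed) phi v <-> sat N phi (inc v) }.

Arguments esub_set {L N} e s _ : rename.

Definition esub_structure L (N : structure L) (M : elementary_substructure N) :
  structure L := substructure (@esub_closed L N M).

Section Closures.
Variables (L : lang) (N : structure L) (A : sset N).

Definition acl : sset N := fun s => [set a |
  exists (G : seq (lsort L)) (phi : formula (s :: G)) (b : tup (sub A) G),
    sat N phi ((a, inc b) : tup N (s :: G)) /\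
    finite_set [set x | sat N phi ((x, inc b) : tup N (s :: G))]].

Definition dcl : sset N := fun s => [set a |
  exists (G : seq (lsort L)) (phi : formula (s :: G)) (b : tup (sub A) G),
    [set x | sat N phi ((x, inc b) : tup N (s :: G))] = [set a]].

Definition definably_closed : Prop := forall s, @dcl s = @A s.

End Closures.

(** * Monster models *)

Section Monster.
(* [kappa] is any type whose cardinality is the saturation of the model. *)
Variables (kappa : Type) (L : lang).

Definition small (N : structure L) (A : sset N) : Prop :=
  ~ ([set: kappa] #<= [set x : {s : lsort L & N s} | A (projT1 x) (projT2 x)]).

(* Formulas over [A] in variables of sorts [J]. *)
Definition param_formula (N : structure L) (A : sset N) (J : seq (lsort L)) : Type :=
  {G : seq (lsort L) & (formula (J ++ G) * tup (sub A) G)%type}.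

Definition realizes (N : structure L) (A : sset N) J (a : tup N J)
    (p : set (param_formula A J)) : Prop :=
  forall x, p x -> sat N (projT2 x).1 (tcat a (inc (projT2 x).2)).

Definition saturated (N : structure L) : Prop :=
  forall A : sset N, small A -> forall J (p : set (param_formula A J)),
    (forall q, finite_set q -> q `<=` p -> exists a, realizes a q) ->
    exists a, realizes a p.

Definition automorphism (N : structure L) (f : forall s, N s -> N s) : Prop :=
  [/\ forall s, bijective (f s),
      forall g v, f _ (fint N g v) = fint N g (tmap f v)
    & forall R v, rint N R (tmap f v) <-> rint N R v].

Definition strongly_homogeneous (N : structure L) : Prop :=
  forall A : sset N, small A -> forall f : (forall s, sub A s -> N s),
    elementary_map f ->
    exists2 g : forall s, N s -> N s, automorphism g &
      forall s (x : sub A s), g s (sval x) = f s x.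

(* The first clause says that the saturation is larger than [|L| + aleph_0]. *)
Definition monster (N : structure L) : Prop :=
  [/\ ~ ([set: kappa] #<= [set: {G : seq (lsort L) & formula G}]),
      saturated N & strongly_homogeneous N].

End Monster.

(** * Groups of elementary permutations *)

(* [aut A B] is Aut(A/B): the permutations of [A] which are elementary in the
   ambient structure and fix the elements of [B] (in use, [B] is a subset
   of [A]). *)
Record aut L (N : structure L) (A B : sset N) := Aut {
  aut_fun :> forall s, sub A s -> sub A s;
  aut_inv : forall s, sub A s -> sub A s;
  aut_funK : forall s, cancel (@aut_fun s) (@aut_inv s);
  aut_invK : forall s, cancel (@aut_inv s) (@aut_fun s);
  aut_elem : elementary_map (fun s x => sval (@aut_fun s x));
  aut_fix : forall s (x : sub A s), B s (sval x) -> @aut_fun s x = x }.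

Arguments aut_fun {L N A B} a s x : rename.
Arguments aut_inv {L N A B} a s x : rename.

Section AutGroup.
Variables (L : lang) (N : structure L) (A B : sset N).
Local Notation aut := (aut A B).

Lemma tmap_comp S (X Y Z : S -> Type) (g : forall s, Y s -> Z s)
    (f : forall s, X s -> Y s) l (v : tup X l) :
  tmap g (tmap f v) = tmap (fun s x => g s (f s x)) v.
Proof. by elim: l v => [|s l IH] //= [x v] /=; rewrite IH. Qed.

Lemma tmap_id S (X : S -> Type) l (v : tup X l) : tmap (fun s x => x) v = v.
Proof. by elim: l v => [|s l IH] /= => [[]|[x v]] //=; rewrite IH. Qed.

Lemma eq_tmap S (X Y : S -> Type) (f g : forall s, X s -> Y s) l (v : tup X l) :
  (forall s x, f s x = g s x) -> tmap f v = tmap g v.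
Proof. by move=> fg; elim: l v => [|s l IH] //= [x v] /=; rewrite fg IH. Qed.

Lemma aut_ext (f g : aut) : (forall s x, f s x = g s x) -> f = g.
Proof.
case: f g => [f f' fK f'K fe ff] [g g' gK g'K ge gf] /= fg.
have {}fg : f = g by apply: functional_extensionality_dep => s; exact/funext/fg.
subst g; have fg' : f' = g'.
  apply: functional_extensionality_dep => s; apply/funext => x.
  by rewrite -[in LHS](g'K s x) fK.
by subst g'; congr Aut; exact: Prop_irrelevance.
Qed.

Fact aut1_subproof1 : elementary_map (fun s (x : sub A s) => sval x).
Proof. by []. Qed.

Definition aut1 : aut := @Aut L N A B (fun s x => x) (fun s x => x)
  (fun s x => erefl) (fun s x => erefl) aut1_subproof1 (fun s x _ => erefl).

Section Mul.
Variables f g : aut.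

Fact autM_subproof1 s : cancel (fun x => f s (g s x))
  (fun x => aut_inv g s (aut_inv f s x)).
Proof. by move=> x; rewrite !aut_funK. Qed.

Fact autM_subproof2 s : cancel (fun x : sub A s => aut_inv g s (aut_inv f s x))
  (fun x => f s (g s x)).
Proof. by move=> x; rewrite !aut_invK. Qed.

Fact autM_subproof3 : elementary_map (fun s x => sval (f s (g s x))).
Proof.
move=> G phi v; apply: (iff_trans (aut_elem g phi v)).
have := aut_elem f phi (tmap g v); rewrite /inc !tmap_comp; exact.
Qed.

Fact autM_subproof4 s (x : sub A s) : @B s (sval x) -> f s (g s x) = x.
Proof. by move=> Bx; rewrite (aut_fix g Bx) (aut_fix f Bx). Qed.

Definition autM : aut := Aut autM_subproof1 autM_subproof2
  autM_subproof3 autM_subproof4.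

Fact autV_subproof1 : elementary_map (fun s x => sval (aut_inv f s x)).
Proof.
move=> G phi v; apply: iff_sym.
have := aut_elem f phi (tmap (aut_inv f) v); rewrite /inc !tmap_comp.
rewrite (@eq_tmap _ _ _ (fun s x => sval (f s (aut_inv f s x)))
  (fun s x => sval x)) //.
by move=> s x; rewrite aut_invK.
Qed.

Fact autV_subproof2 s (x : sub A s) : @B s (sval x) -> aut_inv f s x = x.
Proof. by move=> Bx; rewrite -{1}(aut_fix f Bx) aut_funK. Qed.

Definition autV : aut := Aut (@aut_invK _ _ _ _ f) (@aut_funK _ _ _ _ f)
  autV_subproof1 autV_subproof2.

End Mul.

HB.instance Definition _ := gen_eqMixin aut.
HB.instance Definition _ := gen_choiceMixin aut.

Fact autMA : associative autM. Proof. by move=> f g h; exact: aut_ext. Qed.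
Fact aut1M : left_id aut1 autM. Proof. by move=> f; exact: aut_ext. Qed.
Fact autM1 : right_id aut1 autM. Proof. by move=> f; exact: aut_ext. Qed.
Fact autVM : left_inverse aut1 autV autM.
Proof. by move=> f; apply: aut_ext => s x /=; rewrite aut_funK. Qed.
Fact autMV : right_inverse aut1 autV autM.
Proof. by move=> f; apply: aut_ext => s x /=; rewrite aut_invK. Qed.

HB.instance Definition _ := isGroup.Build aut autMA aut1M autM1 autVM autMV.

(* The topology of pointwise convergence, [A] being discrete; on an absolute
   Galois group this is the profinite topology. *)
Definition aut_open (U : set aut) : Prop :=
  forall g, U g -> exists2 F : set {s : lsort L & sub A s}, finite_set F &
    forall h : aut, (forall x, F x -> h _ (projT2 x) = g _ (projT2 x)) -> U h.

Fact aut_openT : aut_open setT.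
Proof. by move=> g _; exists set0. Qed.

Fact aut_openI : setI_closed aut_open.
Proof.
move=> U V oU oV g [/oU[F finF FU] /oV[F' finF' FV]].
exists (F `|` F'); first by rewrite finite_setU.
by move=> h hg; split; [apply: FU|apply: FV] => x Fx; apply: hg; [left|right].
Qed.

Fact aut_open_bigU (I : Type) (U : I -> set aut) :
  (forall i, aut_open (U i)) -> aut_open (\bigcup_i U i).
Proof.
move=> oU g [i _ /oU[F finF FU]]; exists F => // h /FU Uh; by exists i.
Qed.

HB.instance Definition _ :=
  isOpenTopological.Build aut aut_openT aut_openI aut_open_bigU.

End AutGroup.

(** * Absolute Galois groups and sorted complete systems *)

Section Cosets.
Local Open Scope group_scope.
Variable G : groupType.

Definition normal_subgroup (H : set G) : Prop :=
  [/\ H 1, forall x y, H x -> H y -> H (x * y), forall x, H x -> H x^-1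
    & forall g x, H x -> H (g * x * g^-1)].

Definition lcoset (g : G) (H : set G) : set G := [set g * x | x in H].

Definition index_le (H : set G) (k : nat) : Prop :=
  range (fun g => lcoset g H) #<= `I_k.

End Cosets.

Notation galois_group K := (aut (acl K) (dcl K)).

Section CompleteSystem.
Local Open Scope group_scope.
Variables (L : lang) (N : structure L) (K : sset N).

Definition open_normal (H : set (galois_group K)) : Prop :=
  open H /\ normal_subgroup H.

Definition fixed_set (H : set (galois_group K)) : sset N := fun s =>
  [set sval x | x in [set x : sub (acl K) s | forall g, H g -> g s x = x]].

(* The image of Aut(L/K) -> Aut(S_J(L)/S_J(K)). *)
Definition autJ (A : sset N) (J : seq (lsort L)) :
    set (tup (sub A) J -> tup (sub A) J) :=
  range (fun (g : aut A K) (v : tup (sub A) J) => tmap g v).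

(* The cardinalities compared here are finite when [H] is open. *)
Definition FK (H : set (galois_group K)) : set (seq (lsort L)) :=
  [set J | @autJ (fixed_set H) J #= [set: aut (fixed_set H) K]].

Definition gsort (S : Type) : Type := ({k : nat | 0 < k} * seq S)%type.

Definition in_m (m : gsort (lsort L)) (X : set (galois_group K)) : Prop :=
  exists g H, [/\ open_normal H, index_le H (sval m.1), FK H m.2 & X = lcoset g H].

Definition coset_le (X Y : set (galois_group K)) : Prop :=
  exists g H g' H', [/\ open_normal H, open_normal H',
    X = lcoset g H, Y = lcoset g' H' & H `<=` H'].

Definition coset_C (X Y : set (galois_group K)) : Prop :=
  exists g H g' H', [/\ open_normal H, open_normal H',
    X = lcoset g H, Y = lcoset g' H' & H `<=` H' /\ lcoset g H' = lcoset g' H'].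

Definition coset_P (X Y Z : set (galois_group K)) : Prop :=
  exists g1 g2 g3 H, [/\ open_normal H, X = lcoset g1 H, Y = lcoset g2 H,
    Z = lcoset g3 H & lcoset (g1 * g2) H = lcoset g3 H].

End CompleteSystem.

Inductive lang_G_rel (S : Type) : Type :=
| GLe of gsort S & gsort S
| GC of gsort S & gsort S
| GP of gsort S.

Definition lang_G (S : Type) : lang := @Lang (gsort S)
  False (fun f => match f with end) (fun f => match f with end)
  (lang_G_rel S)
  (fun R => match R with
            | GLe m n | GC m n => [:: m; n]
            | GP m => [:: m; m; m]
            end).

Definition sorted_complete_system L (N : structure L) (K : sset N) :
    structure (lang_G (lsort L)) :=
  @Structure (lang_G (lsort L)) (fun m => {X : set (galois_group K) | in_m m X})
    (fun f => match f with end)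
    (fun R => match R with
     | GLe m n => fun v => coset_le (sval v.1) (sval v.2.1)
     | GC m n => fun v => coset_C (sval v.1) (sval v.2.1)
     | GP m => fun v => coset_P (sval v.1) (sval v.2.1) (sval v.2.2.1)
     end).

(** * The expansion by a predicate *)

Definition lang_P (L : lang) : lang := @Lang (lsort L)
  (lfn L) (@fn_dom L) (@fn_cod L)
  (lrel L + lsort L)%type
  (fun R => match R with inl R => rel_ar R | inr s => [:: s] end).

Definition expandP L (M : structure L) (K : sset M) : structure (lang_P L) :=
  @Structure (lang_P L) M (fint M)
    (fun R => match R with
     | inl R => fun v => rint M R v
     | inr s => fun v => K s v.1
     end).

(** * Interpretations without parameters *)

(* Each sort of [N] is identified, through [int_map], with a definable set of
   imaginaries of [M], that is of classes of a definable equivalence relation on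
   a finite product of sorts; a relation between imaginaries is definable when
   the corresponding relation between representatives is. *)
Record interpretation L1 (N : structure L1) L2 (M : structure L2) := {
  int_ar : lsort L1 -> seq (lsort L2);
  int_dom : forall s, set (tup M (int_ar s));
  int_eq : forall s, tup M (int_ar s) -> tup M (int_ar s) -> Prop;
  int_map : forall s, N s -> set (tup M (int_ar s));
  int_eq_equiv : forall s, RelationClasses.Equivalence (@int_eq s);
  int_dom_def : forall s, exists phi : formula (int_ar s),
    forall a, int_dom a <-> sat M phi a;
  int_eq_def : forall s, exists phi : formula (int_ar s ++ int_ar s),
    forall a b, int_eq a b <-> sat M phi (tcat a b);
  int_map_bij : forall s, set_bij [set: N s]
    [set [set b | int_eq a b] | a in @int_dom s] (@int_map s);
  int_rel_def : forall R : lrel L1,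
    exists phi : formula (flatten (map int_ar (rel_ar R))),
    forall (n : tup N (rel_ar R)) (a : tup (fun s => tup M (int_ar s)) (rel_ar R)),
      tall2 (fun s x b => int_map x b) n a ->
      (rint N R n <-> sat M phi (tflatten a));
  int_fn_def : forall f : lfn L1,
    exists phi : formula (flatten (map int_ar (fn_dom f)) ++ int_ar (fn_cod f)),
    forall (n : tup N (fn_dom f)) (y : N (fn_cod f))
      (a : tup (fun s => tup M (int_ar s)) (fn_dom f)) (b : tup M (int_ar (fn_cod f))),
      tall2 (fun s x b => int_map x b) n a -> int_map y b ->
      (fint N f n = y <-> sat M phi (tcat (tflatten a) b)) }.

Definition interpretable L1 (N : structure L1) L2 (M : structure L2) : Prop :=
  inhabited (interpretation N M).

(* Main.v *)
Require Import Defs.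
From mathcomp Require Import finmap all_boot boolp classical_sets.
From mathcomp Require Import functions cardinality topology.
Local Open Scope classical_set_scope.
Local Open Scope card_scope.

(** An element of [G = Aut(acl K/dcl K)] is seen in [(M, K)] through its action
on finite tuples of [acl K], so the key point is that conjugacy of such tuples is
definable there without parameters.  By elimination of imaginaries the sets of at
most [n] tuples of a given sort have codes, and as [K] is definably closed such a
set is [K]-definable iff its code lies in [P].  The [G]-orbit of an algebraic
tuple [x] is the least finite [K]-definable set containing [x] (by homogeneity of
the monster), hence "[y] is conjugate to [x] and the orbit of [x] has at most [n]
elements" says: some set of at most [n] tuples coded in [P] contains [x], and all
those that contain [x] contain [y].

An open normal [H] is the stabilizer of a tuple fixed by [H], namely of the code of
the [H]-orbit of a suitable finite tuple.  If [H] has index at most [k], then [J]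
is in [F_K(H)] iff [Aut(L/K)] acts faithfully on [S_J(L)], iff [H] is the
stabilizer of some [x] in [S_J(L)^k] (at least when [S_J(L)] is not empty).  The
coset [gH] is then represented by the pair [(x, g x)], and equality, inclusion and
product of cosets are expressed by conjugacy of concatenated tuples. *)

Set Implicit Arguments.
Unset Strict Implicit.
Unset Printing Implicit Defensive.

(** * Tuples *)

Section TupleTheory.
Context {S : Type}.
Implicit Types (A B : S -> Type) (l J : seq S).

(** The obstacle is that elements of [G] are not objects of [(M, K)]: formulas quantify over finite
    tuples only. A statement about all [g] with [g x = y] is therefore traded for one about tuples:
    some such [g] sends [x'] to [t] exactly when [(x, x')] and [(y, t)] are conjugate. Conjugacy
    itself is only expressed under an explicit bound on the orbit, since being finite is not
    first-order. Bounds are at hand: a tuple whose stabilizer has index at most [k] has at most [k]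
    conjugates, and concatenation multiplies bounds, whence [k * k']. The exponent in [S_J(L)^k] has
    the same origin: for each of the at most [k] cosets, if it is not [H] itself, faithfulness gives
    a [J]-tuple fixed by [H] and moved by that coset; all of them together have stabilizer [H]. Two
    facts keep everything inside [M]. It contains [acl K], so orbits do not leave it. It is a model
    of [T], so uniformity of the elimination makes one formula compute the code of a finite set in
    [M] and in the monster alike. *)

Fixpoint tfst A l1 l2 : tup A (l1 ++ l2) -> tup A l1 :=
  match l1 return tup A (l1 ++ l2) -> tup A l1 with
  | [::] => fun _ => tt
  | s :: l => fun v => (v.1, tfst v.2)
  end.

Fixpoint tsnd A l1 l2 : tup A (l1 ++ l2) -> tup A l2 :=
  match l1 return tup A (l1 ++ l2) -> tup A l2 with
  | [::] => fun v => v
  | s :: l => fun v => tsnd v.2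
  end.

Lemma tfstK A l1 l2 (v : tup A l1) (w : tup A l2) : tfst (tcat v w) = v.
Proof. by elim: l1 v => [[]|s l IH [x v]] //=; rewrite IH. Qed.

Lemma tsndK A l1 l2 (v : tup A l1) (w : tup A l2) : tsnd (tcat v w) = w.
Proof. by elim: l1 v => [[]|s l IH [x v]] //=; rewrite IH. Qed.

Lemma tcatK A l1 l2 (v : tup A (l1 ++ l2)) : tcat (tfst v) (tsnd v) = v.
Proof. by elim: l1 v => [|s l IH] //= [x v] /=; rewrite IH. Qed.

Lemma tup_nil A (v w : tup A [::]) : v = w.
Proof. by case: v; case: w. Qed.

Lemma tmap_tcat A B (f : forall s, A s -> B s) l1 l2 (v : tup A l1) (w : tup A l2) :
  tmap f (tcat v w) = tcat (tmap f v) (tmap f w).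
Proof. by elim: l1 v => [[]|s l IH [x v]] //=; rewrite IH. Qed.

Lemma tmap_tfst A B (f : forall s, A s -> B s) l1 l2 (v : tup A (l1 ++ l2)) :
  tmap f (tfst v) = tfst (tmap f v).
Proof. by rewrite -{2}[v]tcatK tmap_tcat tfstK. Qed.

Lemma tmap_tsnd A B (f : forall s, A s -> B s) l1 l2 (v : tup A (l1 ++ l2)) :
  tmap f (tsnd v) = tsnd (tmap f v).
Proof. by rewrite -{2}[v]tcatK tmap_tcat tsndK. Qed.

Lemma tget_tmap A B (f : forall s, A s -> B s) l s (x : var l s) (v : tup A l) :
  tget x (tmap f v) = f s (tget x v).
Proof. by elim: x v => //= *. Qed.

Lemma tget_ttab A l (f : forall s, var l s -> A s) s (x : var l s) :
  tget x (ttab f) = f s x.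
Proof. by elim: x f => [s' l'|s' s0 l' y IH] f //=; rewrite IH. Qed.

(** The list is an index of [var], so the match returns a statement quantified over all motives [P],
    and a trivial one for the empty list; no equation between indices has to be handled. *)
Lemma var_cons s0 l (P : forall s, var (s0 :: l) s -> Prop) :
  P s0 (VZ s0 l) -> (forall s y, P s (VS s0 y)) -> forall s x, P s x.
Proof.
move=> PZ PS s x; move: P PZ PS; refine (
  match x as x' in var l' s' return
    match l' as l' return var l' s' -> Prop with
    | [::] => fun _ => True
    | s0 :: l => fun x => forall P : (forall s, var (s0 :: l) s -> Prop),
        P s0 (VZ s0 l) -> (forall s y, P s (VS s0 y)) -> P s' x
    end x'
  with VZ _ _ => _ | VS _ _ _ _ => _ end) => //.
Qed.

Lemma eq_tget A l (v w : tup A l) :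
  (forall s (x : var l s), tget x v = tget x w) -> v = w.
Proof.
elim: l v w => [|s l IH] /=; first by case=> [] [].
case=> [x v] [y w] h; congr pair; first exact: (h s (VZ s l)).
by apply: IH => s' z; exact: (h s' (VS s z)).
Qed.

Lemma tmap_ttab A B (f : forall s, A s -> B s) l (h : forall s, var l s -> A s) :
  tmap f (ttab h) = ttab (fun s x => f s (h s x)).
Proof. by apply: eq_tget => s x; rewrite tget_tmap !tget_ttab. Qed.

Lemma ttab_tget A l (v : tup A l) : ttab (fun s x => tget x v) = v.
Proof. by apply: eq_tget => s x; rewrite tget_ttab. Qed.

Lemma tmap_inj A B (f : forall s, A s -> B s) l :
  (forall s, injective (f s)) -> injective (@tmap S A B f l).
Proof.
move=> finj v w vw; apply: eq_tget => s x; apply: finj.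
by rewrite -!tget_tmap vw.
Qed.

(** A tuple over [pow n J] is a list of [n] tuples over [J]. Repetitions being allowed, its members
    under [tmem] form an arbitrary set of at most [n] tuples, nonempty if [n > 0]. *)
Definition pow (n : nat) J : seq S := flatten (nseq n J).

Fixpoint tmem A n J : tup A J -> tup A (pow n J) -> Prop :=
  match n return tup A J -> tup A (pow n J) -> Prop with
  | 0 => fun _ _ => False
  | n'.+1 => fun x z => tfst z = x \/ tmem x (tsnd z)
  end.

Fixpoint pack A n J (f : nat -> tup A J) : tup A (pow n J) :=
  match n return tup A (pow n J) with
  | 0 => tt
  | n'.+1 => tcat (f 0) (pack n' (fun i => f i.+1))
  end.

Lemma tmem_pack A n J (f : nat -> tup A J) x :
  tmem x (pack n f) <-> exists2 i, (i < n)%N & f i = x.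
Proof.
elim: n f => [|n IH] f /=; first by split=> // -[].
rewrite tfstK tsndK IH; split=> [[<-|[i i_n <-]]|[[|i]]].
- by exists 0%N.
- by exists i.+1.
- by left.
- by right; exists i.
Qed.

Lemma tmap_pack A B (f : forall s, A s -> B s) n J (h : nat -> tup A J) :
  tmap f (pack n h) = pack n (fun i => tmap f (h i)).
Proof. by elim: n h => [|n IH] h //=; rewrite tmap_tcat IH. Qed.

Lemma tmem_tmap A B (f : forall s, A s -> B s) n J (x : tup A J) (z : tup A (pow n J)) :
  (forall s, injective (f s)) -> tmem (tmap f x) (tmap f z) <-> tmem x z.
Proof.
move=> finj; elim: n z => [|n IH] z //=.
rewrite -tmap_tsnd IH -tmap_tfst.
by split=> -[h|]; [left; exact: tmap_inj h|right|left; rewrite h|right].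
Qed.

Lemma tmem_tmap_inv A B (f : forall s, A s -> B s) n J (x : tup B J)
    (z : tup A (pow n J)) :
  tmem x (tmap f z) -> exists2 m, tmem m z & x = tmap f m.
Proof.
elim: n z => [|n IH] z //=; rewrite -tmap_tfst -tmap_tsnd => -[<-|/IH[m mz ->]].
  by exists (tfst z); first left.
by exists m; first right.
Qed.

Lemma tmem_enum A n J (z : tup A (pow n J)) (x0 : tup A J) :
  exists f : nat -> tup A J, forall x, tmem x z -> exists2 i, (i < n)%N & f i = x.
Proof.
elim: n z => [|n IH] z /=; first by exists (fun=> x0).
have [f fP] := IH (tsnd z).
exists (fun i => if i is i'.+1 then f i' else tfst z) => x [<-|/fP[i i_n <-]].
  by exists 0%N.
by exists i.+1.
Qed.

End TupleTheory.

(** * Uniform definability *)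

Section Renaming.
Variable L : lang.
Implicit Types (G J : seq (lsort L)).

(* A renaming is a tuple of variables, so that renamings, like tuples of values,
   are built by [tcat], [tfst] and [tsnd]. *)
Definition vsub (A : lsort L -> Type) G J (r : tup (var G) J) (v : tup A G) :
  tup A J := tmap (fun s x => tget x v) r.

Definition vid G : tup (var G) G := ttab (fun s x => x).

Lemma vsub_id A G (v : tup A G) : vsub (vid G) v = v.
Proof. by rewrite /vsub /vid tmap_ttab ttab_tget. Qed.

Lemma vsub_tfst A G J J' (r : tup (var G) (J ++ J')) (v : tup A G) :
  vsub (tfst r) v = tfst (vsub r v).
Proof. exact: tmap_tfst. Qed.

Lemma vsub_tsnd A G J J' (r : tup (var G) (J ++ J')) (v : tup A G) :
  vsub (tsnd r) v = tsnd (vsub r v).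
Proof. exact: tmap_tsnd. Qed.

Lemma vsub_tcat A G J J' (r : tup (var G) J) (t : tup (var G) J') (v : tup A G) :
  vsub (tcat r t) v = tcat (vsub r v) (vsub t v).
Proof. exact: tmap_tcat. Qed.

Lemma vsub_comp A G J J' (r : tup (var J) J') (t : tup (var G) J) (v : tup A G) :
  vsub (vsub r t) v = vsub r (vsub t v).
Proof.
by rewrite /vsub tmap_comp; apply: eq_tmap => s x; rewrite tget_tmap.
Qed.

Lemma tget_vsub A G J (r : tup (var G) J) (v : tup A G) s (x : var J s) :
  tget (tget x r) v = tget x (vsub r v).
Proof. by rewrite tget_tmap. Qed.

Fixpoint trename G J (r : tup (var G) J) s (t : term J s) : term G s :=
  match t with
  | Var _ x => Var (tget x r)
  | App f ts => App (fun s y => trename r (ts s y))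
  end.

Lemma eval_trename (N : structure L) G J (r : tup (var G) J) s (t : term J s)
    (v : tup N G) : Defs.eval (trename r t) v = Defs.eval t (vsub r v).
Proof.
elim: t => [s' x|f ts IH] /=; first by rewrite tget_tmap.
by congr fint; apply: eq_tget => s' y; rewrite !tget_ttab IH.
Qed.

Definition vlift G J (r : tup (var G) J) s : tup (var (s :: G)) (s :: J) :=
  (VZ s G, tmap (fun s' x => VS s x) r).

Fixpoint rename J (phi : formula J) G (r : tup (var G) J) : formula G :=
  match phi with
  | Bot => Bot
  | Eq s t u => Eq (trename r t) (trename r u)
  | Rel R ts => Rel (tmap (fun s t => trename r t) ts)
  | Imp p q => Imp (rename p r) (rename q r)
  | All s p => All (rename p (vlift r s))
  end.

Lemma sat_rename (N : structure L) J (phi : formula J) G (r : tup (var G) J)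
    (v : tup N G) : sat N (rename phi r) v <-> sat N phi (vsub r v).
Proof.
elim: phi G r v => {J} [J|J s t u|J R ts|J p IHp q IHq|J s p IHp] G r v /=.
- by [].
- by rewrite !eval_trename.
- rewrite tmap_comp (@eq_tmap _ _ _ _ (fun s t => Defs.eval t (vsub r v))) // => s t.
  exact: eval_trename.
- by rewrite IHp IHq.
- have E a : vsub (vlift r s) ((a, v) : tup N (s :: G)) = (a, vsub r v).
    by rewrite /vsub /= tmap_comp.
  by split=> h a; move: (h a); rewrite IHp E.
Qed.

End Renaming.

Section Definability.
Variables (L : lang) (I : Type) (N : I -> structure L).
Implicit Types (G J : seq (lsort L)).

(* One formula has to serve for all the structures [N i] at once: the equivalence
   relations of [uniform_elimination_of_imaginaries] are given by a formula in all
   models. *)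
Definition udef G (X : forall i, tup (N i) G -> Prop) :=
  exists phi : formula G, forall i v, X i v <-> sat (N i) phi v.

Definition varmap G J (p : forall i, tup (N i) G -> tup (N i) J) :=
  exists r : tup (var G) J, forall i v, p i v = vsub r v.

Lemma varmap_id G : varmap (fun i (v : tup (N i) G) => v).
Proof. by exists (vid G) => i v; rewrite vsub_id. Qed.

Lemma varmap_comp G J J' (p : forall i, tup (N i) J -> tup (N i) J')
    (q : forall i, tup (N i) G -> tup (N i) J) :
  varmap p -> varmap q -> varmap (fun i v => p i (q i v)).
Proof.
by case=> r rE [t tE]; exists (vsub r t) => i v; rewrite rE tE vsub_comp.
Qed.

Lemma varmap_tfst G J J' (p : forall i, tup (N i) G -> tup (N i) (J ++ J')) :
  varmap p -> varmap (fun i v => tfst (p i v)).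
Proof. by case=> r rE; exists (tfst r) => i v; rewrite rE /vsub tmap_tfst. Qed.

Lemma varmap_tsnd G J J' (p : forall i, tup (N i) G -> tup (N i) (J ++ J')) :
  varmap p -> varmap (fun i v => tsnd (p i v)).
Proof. by case=> r rE; exists (tsnd r) => i v; rewrite rE /vsub tmap_tsnd. Qed.

Lemma varmap_tcat G J J' (p : forall i, tup (N i) G -> tup (N i) J)
    (q : forall i, tup (N i) G -> tup (N i) J') :
  varmap p -> varmap q -> varmap (fun i v => tcat (p i v) (q i v)).
Proof.
case=> r rE [t tE]; exists (tcat r t) => i v.
by rewrite rE tE /vsub tmap_tcat.
Qed.

Lemma udef_ext G (X Y : forall i, tup (N i) G -> Prop) :
  (forall i v, X i v <-> Y i v) -> udef X -> udef Y.
Proof. by move=> XY [phi h]; exists phi => i v; rewrite -XY. Qed.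

Lemma udef_formula G (phi : formula G) : udef (fun i v => sat (N i) phi v).
Proof. by exists phi. Qed.

Lemma udef_varmap J (X : forall i, tup (N i) J -> Prop) G
    (p : forall i, tup (N i) G -> tup (N i) J) :
  udef X -> varmap p -> udef (fun i v => X i (p i v)).
Proof.
case=> phi h [r rE]; exists (rename phi r) => i v.
by rewrite rE sat_rename -h.
Qed.

Lemma udef_varmap2 J J' (R : forall i, tup (N i) J -> tup (N i) J' -> Prop) G
    (p : forall i, tup (N i) G -> tup (N i) J)
    (q : forall i, tup (N i) G -> tup (N i) J') :
  udef (fun i (w : tup (N i) (J ++ J')) => R i (tfst w) (tsnd w)) ->
  varmap p -> varmap q -> udef (fun i v => R i (p i v) (q i v)).
Proof.
move=> dR vp vq; have := udef_varmap dR (varmap_tcat vp vq).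
by apply: udef_ext => i v; rewrite tfstK tsndK.
Qed.

Lemma udef_False G : udef (fun i (v : tup (N i) G) => False).
Proof. by exists Bot. Qed.

Lemma udef_imp G (X Y : forall i, tup (N i) G -> Prop) :
  udef X -> udef Y -> udef (fun i v => X i v -> Y i v).
Proof.
by case=> [phi hphi] [psi hpsi]; exists (Imp phi psi) => i v /=;
   rewrite hphi hpsi.
Qed.

Lemma udef_not G (X : forall i, tup (N i) G -> Prop) :
  udef X -> udef (fun i v => ~ X i v).
Proof. by move=> dX; exact: udef_imp dX (udef_False G). Qed.

Lemma udef_or G (X Y : forall i, tup (N i) G -> Prop) :
  udef X -> udef Y -> udef (fun i v => X i v \/ Y i v).
Proof.
move=> dX dY; apply: udef_ext (udef_imp (udef_not dX) dY) => i v /=.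
split=> [h|[]//]; have [|] := pselect (X i v); first by left.
by right; exact: h.
Qed.

Lemma udef_and G (X Y : forall i, tup (N i) G -> Prop) :
  udef X -> udef Y -> udef (fun i v => X i v /\ Y i v).
Proof.
move=> dX dY.
apply: udef_ext (udef_not (udef_imp dX (udef_not dY))) => i v /=.
split=> [h|[x y]]; last by move/(_ x).
by apply: contrapT => h'; apply: h => x y; apply: h'.
Qed.

Lemma udef_iff G (X Y : forall i, tup (N i) G -> Prop) :
  udef X -> udef Y -> udef (fun i v => X i v <-> Y i v).
Proof. by move=> dX dY; apply: udef_and; apply: udef_imp. Qed.

Lemma udef_all J G (Q : forall i, tup (N i) J -> tup (N i) G -> Prop) :
  udef (fun i (w : tup (N i) (J ++ G)) => Q i (tfst w) (tsnd w)) ->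
  udef (fun i v => forall t, Q i t v).
Proof.
elim: J G Q => [|s J IH] G Q dQ.
  by apply: udef_ext dQ => i v /=; split=> [h []|h].
(* The head of the quantified tuple is moved into the context, so that the induction hypothesis
   applies to the tail; [v1] below is the corresponding permutation of variables. *)
have [phi h] : udef (fun i (v : tup (N i) (s :: G)) =>
    forall t : tup (N i) J, Q i ((v.1, t) : tup (N i) (s :: J)) v.2).
  apply: (IH (s :: G)
    (fun i t v => Q i ((v.1, t) : tup (N i) (s :: J)) v.2)).
  have v1 : varmap (fun i (w : tup (N i) (J ++ s :: G)) =>
      tcat (tcat (tfst (tsnd w : tup (N i) ([:: s] ++ G)) : tup (N i) [:: s])
       (tfst w)) (tsnd (tsnd w : tup (N i) ([:: s] ++ G)))).
    have v0 := varmap_tsnd (varmap_id (J ++ [:: s] ++ G)).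
    apply: varmap_tcat; last exact: varmap_tsnd.
    by apply: varmap_tcat; [exact: varmap_tfst|apply/varmap_tfst/varmap_id].
  by have := udef_varmap dQ v1; apply: udef_ext => i w /=; rewrite tfstK tsndK.
exists (All phi) => i v /=; split=> [Qv a|Qv [a t]].
  by rewrite -h => t; exact: Qv.
by have := Qv a; rewrite -h; apply.
Qed.

Lemma udef_ex J G (Q : forall i, tup (N i) J -> tup (N i) G -> Prop) :
  udef (fun i (w : tup (N i) (J ++ G)) => Q i (tfst w) (tsnd w)) ->
  udef (fun i v => exists t, Q i t v).
Proof.
move=> dQ; have := udef_not (@udef_all J G (fun i t v => ~ Q i t v) (udef_not dQ)).
apply: udef_ext => i v; split=> [h|[t Qt] /(_ t)//].
by apply: contrapT => h'; apply: h => t Qt; apply: h'; exists t.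
Qed.

(** The quantifier over positions is external to the language and unfolds to a finite
    conjunction. *)
Lemma udef_all_var J G (Q : forall s, var J s -> forall i, tup (N i) G -> Prop) :
  (forall s x, udef (Q s x)) -> udef (fun i v => forall s x, Q s x i v).
Proof.
elim: J Q => [|s0 J IH] Q dQ.
  apply: udef_ext (udef_not (udef_False G)) => i v.
  by split=> [_ s x|_ []]; inversion x.
apply: udef_ext (udef_and (dQ _ (VZ s0 J)) (IH (fun s x => Q s (VS s0 x)) _)).
  move=> i v; split=> [[QZ QS]|h]; last by split=> [|s x]; exact: h.
  exact: var_cons.
by move=> s x; exact: dQ.
Qed.

Lemma udef_eq J : udef (fun i (w : tup (N i) (J ++ J)) => tfst w = tsnd w).
Proof.
have : udef (fun i (w : tup (N i) (J ++ J)) =>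
    forall s (x : var J s), tget x (tfst w) = tget x (tsnd w)).
  apply: udef_all_var => s x.
  have [r rE] := varmap_tfst (varmap_id (J ++ J)).
  have [t tE] := varmap_tsnd (varmap_id (J ++ J)).
  exists (Eq (Var (tget x r)) (Var (tget x t))) => i v /=.
  by rewrite rE tE !tget_tmap.
by apply: udef_ext => i w; split=> [|-> //]; exact: eq_tget.
Qed.

Lemma udef_tmem n J :
  udef (fun i (w : tup (N i) (J ++ pow n J)) => tmem (tfst w) (tsnd w)).
Proof.
elim: n => [|n IH]; first exact: udef_False.
have v1 := varmap_tfst (varmap_id (J ++ J ++ pow n J)).
have v2 := varmap_tsnd (varmap_id (J ++ J ++ pow n J)).
apply: (@udef_or _ (fun i w => tfst (tsnd w : tup (N i) (J ++ pow n J)) = tfst w)).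
  apply: (udef_varmap2 (R := fun i u v => u = v)) v1; first exact: udef_eq.
  exact: varmap_tfst.
by apply: (udef_varmap2 (R := fun i u v => tmem u v)) v1 _ => //; exact: varmap_tsnd.
Qed.

End Definability.

(** * Codes of finite sets *)

(** Elimination is applied to the relation of having the same members, so that [c] codes the set
    listed by [z]. The family of structures in [udef] is here that of all structures, because one
    [eps] must serve in every model. *)
Lemma set_code (L : lang) (T : set (sentence L)) (n : nat) (J : seq (lsort L)) :
  uniform_elimination_of_imaginaries T ->
  exists (J' : seq (lsort L)) (chi : formula (pow n J ++ J')),
    forall N, models T N ->
      (forall z : tup N (pow n J), exists! c, sat N chi (tcat z c)) /\
      (forall z z' : tup N (pow n J), (forall x, tmem x z <-> tmem x z') <->
         exists2 c, sat N chi (tcat z c) & sat N chi (tcat z' c)).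
Proof.
move=> uei.
have [eps epsP] : udef (N := fun N : structure L => N)
    (fun N (w : tup N (pow n J ++ pow n J)) =>
      forall x, tmem x (tfst w) <-> tmem x (tsnd w)).
  apply: (@udef_all _ _ _ J _ (fun N x w => tmem x (tfst w) <-> tmem x (tsnd w))).
  have v0 := varmap_id (fun N : structure L => N) (J ++ pow n J ++ pow n J).
  have v1 := varmap_tfst v0.
  by apply: udef_iff; apply: (udef_varmap2 (R := fun N u v => tmem u v)) v1 _;
    [exact: udef_tmem|apply/varmap_tfst/varmap_tsnd|
     exact: udef_tmem|apply/varmap_tsnd/varmap_tsnd].
have epsE (N : structure L) (a b : tup N (pow n J)) :
    sat N eps (tcat a b) <-> (forall x, tmem x a <-> tmem x b).
  by rewrite -epsP tfstK tsndK.
have [N _|J' [chi chiP]] := uei (pow n J) eps.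
  split=> [a|a b|a b c]; rewrite !epsE //.
    by move=> h x; rewrite h.
  by move=> h h' x; rewrite h.
exists J', chi => N /chiP[chif chiE]; split=> // z z'.
by rewrite -epsE chiE.
Qed.

Section DefinableOver.
Variables (L : lang) (C : structure L) (K : sset C).
Implicit Types (J G : seq (lsort L)).

Definition def J (X : set (tup C J)) : Prop :=
  udef (N := fun _ : unit => C) (fun _ => X).

Definition Kdef J (X : set (tup C J)) : Prop :=
  exists G (phi : formula (J ++ G)) (k : tup (sub K) G),
    forall x, X x <-> sat C phi (tcat x (inc k)).

Lemma Kdef_intro J G (R : tup C J -> tup C G -> Prop) (k : tup (sub K) G) :
  def (fun w : tup C (J ++ G) => R (tfst w) (tsnd w)) -> Kdef (fun x => R x (inc k)).
Proof.
case=> phi phiP; exists G, phi, k => x.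
by rewrite -(phiP tt) tfstK tsndK.
Qed.

Lemma def_Kdef J (X : set (tup C J)) : def X -> Kdef X.
Proof.
move=> dX; apply: (@Kdef_intro J [::] (fun x _ => X x) tt).
apply: (udef_varmap (X := fun _ => X) (p := fun _ w => tfst w)) dX _.
exact/varmap_tfst/varmap_id.
Qed.

Lemma Kdef_setC J (X : set (tup C J)) : Kdef X -> Kdef (~` X).
Proof.
case=> G [phi [k phiP]].
by exists G, (Imp phi Bot), k => x; rewrite /= -phiP.
Qed.

Lemma Kdef_setI J (X Y : set (tup C J)) : Kdef X -> Kdef Y -> Kdef (X `&` Y).
Proof.
case=> G [phi [k phiP]] [G' [psi [k' psiP]]].
have v0 := varmap_id (fun _ : unit => C) (J ++ G ++ G').
have v1 := varmap_tfst v0.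
have v2 := varmap_tfst (varmap_tsnd v0).
have v3 := varmap_tsnd (varmap_tsnd v0).
have := @Kdef_intro J (G ++ G') (fun x k => sat C phi (tcat x (tfst k)) /\
  sat C psi (tcat x (tsnd k))) (tcat k k').
rewrite /inc tmap_tcat tfstK tsndK => h.
suff : Kdef (fun x => sat C phi (tcat x (inc k)) /\ sat C psi (tcat x (inc k'))).
  case=> G1 [phi1 [k1 h1]]; exists G1, phi1, k1 => x.
  by rewrite -h1 /setI /= phiP psiP.
apply: h; apply: udef_and.
  exact: udef_varmap (udef_formula _ phi) (varmap_tcat v1 v2).
exact: udef_varmap (udef_formula _ psi) (varmap_tcat v1 v3).
Qed.

Lemma Kdef_ext J (X Y : set (tup C J)) : (forall x, X x <-> Y x) -> Kdef X -> Kdef Y.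
Proof.
by move=> XY [G [phi [k h]]]; exists G, phi, k => x; rewrite -XY.
Qed.

Lemma tup_inc (A : sset C) J (x : tup C J) :
  (forall s (i : var J s), A s (tget i x)) -> exists u : tup (sub A) J, inc u = x.
Proof.
elim: J x => [|s J IH] /= x Ax; first by exists tt; case: x Ax.
case: x Ax => x y Ax.
have [|u uy] := IH y; first by move=> s' i; exact: (Ax s' (VS s i)).
by exists (exist _ x (Ax s (VZ s J)), u); rewrite /inc /=; congr pair.
Qed.

Lemma inc_in (A : sset C) J (u : tup (sub A) J) s (i : var J s) : A s (tget i (inc u)).
Proof. by rewrite /inc tget_tmap; case: (tget i u). Qed.

Lemma inc_inj (A : sset C) J : injective (@inc L C A J).
Proof. by apply: tmap_inj => s [x ?] [y ?] /= xy; exact: eq_exist. Qed.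

Lemma inc_tcat (A : sset C) J J' (u : tup (sub A) J) (v : tup (sub A) J') :
  inc (tcat u v) = tcat (inc u) (inc v).
Proof. exact: tmap_tcat. Qed.

Lemma acl_finite_Kdef J (u : tup (sub (acl K)) J) :
  exists X, [/\ Kdef X, finite_set X & X (inc u)].
Proof.
elim: J u => [|s J IH] u.
  exists setT; split=> //.
    exists [::], (Imp Bot Bot), tt => x; by split=> // _.
  by apply: (@sub_finite_set _ _ [set tt]) => // -[].
case: u => -[a aclA] u; have [X [[G' [psi [k' psiP]]] finX Xu]] := IH u.
have [G [phi [k [phia finphi]]]] := aclA.
exists (fun x => sat C phi ((x.1, inc k) : tup C (s :: G)) /\ X x.2); split=> //.
- have v0 := varmap_id (fun _ : unit => C) ((s :: J) ++ G ++ G').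
  have v1 := varmap_tfst v0.
  have v2 := varmap_tfst (varmap_tsnd v0).
  have v3 := varmap_tsnd (varmap_tsnd v0).
  have vh := varmap_tfst (J := [:: s]) (J' := J) v1.
  have vt := varmap_tsnd (J := [:: s]) (J' := J) v1.
  have := @Kdef_intro (s :: J) (G ++ G')
    (fun x k => sat C phi ((x.1, tfst k) : tup C (s :: G)) /\
      sat C psi (tcat (x.2 : tup C J) (tsnd k))) (tcat k k').
  rewrite /inc tmap_tcat tfstK tsndK => h.
  apply: Kdef_ext (h _) => [x|]; first by rewrite -psiP.
  apply: udef_and.
    exact: (udef_varmap (udef_formula _ phi) (varmap_tcat vh v2)).
  exact: (udef_varmap (udef_formula _ psi) (varmap_tcat vt v3)).
- have := finite_setX finphi finX.
  by apply: sub_finite_set => -[x y] [].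
Qed.

(** Each projection of [X] to a coordinate is again [K]-definable and finite, which makes the
    coordinates of [x] algebraic. *)
Lemma finite_Kdef_acl J (X : set (tup C J)) (x : tup C J) :
  Kdef X -> finite_set X -> X x -> exists u : tup (sub (acl K)) J, inc u = x.
Proof.
move=> [G [phi [k phiP]]] finX Xx; apply: tup_inc => s i.
have [r rE] := varmap_tfst (varmap_id (fun _ : unit => C) (J ++ s :: G)).
have [psi psiP] : def (fun w : tup C (s :: G) =>
    exists x : tup C J, sat C phi (tcat x (w.2 : tup C G)) /\ w.1 = tget i x).
  apply: (@udef_ex _ _ _ J (s :: G) (fun _ x w =>
    sat C phi (tcat x (w.2 : tup C G)) /\ w.1 = tget i x)).
  have v0 := varmap_id (fun _ : unit => C) (J ++ [:: s] ++ G).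
  apply: udef_and.
    apply: (udef_varmap (udef_formula _ phi)).
    apply: varmap_tcat (varmap_tfst v0) _.
    exact: varmap_tsnd (varmap_tsnd v0).
  have [t tE] := varmap_tfst (varmap_tsnd v0).
  exists (Eq (Var t.1) (Var (tget i r))) => -[] w /=.
  by have := tE tt w; have /= -> := rE tt w; rewrite /vsub tget_tmap /= => -[<-].
exists G, psi, k; split.
  by apply/(psiP tt _); exists x; split=> //; rewrite -phiP.
apply: sub_finite_set (finite_image (fun x => tget i x) finX) => y /=.
by move/(psiP tt (y, inc k)) => /= [z [phiz ->]]; exists z => //; rewrite phiP.
Qed.

End DefinableOver.

(** * Homogeneity and orbits *)

(** Hilbert's hotel along a sequence [i] outside [F]: elements of [F], numbered by [q], go to even
    places, the point [i m] goes to place [2m + 1], and all other points stay. *)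
Lemma infinite_avoid (T : Type) (F : set T) :
  infinite_set [set: T] -> finite_set F ->
  exists2 h : T -> T, injective h & forall x, ~ F (h x).
Proof.
move=> infT finF.
have /infiniteP : infinite_set ([set: T] `\` F) by exact: infinite_setD.
move: infT; elim/Ppointed: T => T in F finF *.
  by move=> []; rewrite emptyE; exact: finite_set0.
move=> _ /ppcard_leP[i].
have iF m : ~ F (i m) by have [] := 'funS_i (I : [set: nat] m).
have iinj m n : i m = i n -> m = n by apply: inj; rewrite inE.
have /countable_injP[q qinj] := finite_set_countable finF.
pose h x := if pselect (F x) then i (q x).*2 else
  if pselect (exists m, i m = x) is left e then i (sval (cid e)).*2.+1 else x.
exists h => [x y|x]; rewrite /h.
  case: (pselect (F x)) => Fx; case: (pselect (F y)) => Fy /=.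
  - by move=> /= /iinj /double_inj /qinj; apply; rewrite inE.
  - case: pselect => [e|ne] /=; last by move=> E; case: ne; exists (q x).*2.
    by move=> /iinj /(congr1 odd); rewrite /= !odd_double.
  - case: pselect => [e|ne] /=; last by move=> E; case: ne; exists (q y).*2.
    by move=> /iinj /(congr1 odd); rewrite /= !odd_double.
  case: pselect => [e|ne]; case: pselect => [e'|ne'] //=.
  - case: (cid e) => m im; case: (cid e') => m' im' /= /iinj [] /double_inj mm'.
    by rewrite -im mm'.
  - by move=> E; case: ne'; eexists; exact: E.
  - by move=> E; case: ne; eexists; apply: esym; exact: E.
by case: (pselect (F x)) => Fx //=; case: pselect => [e|ne] //=; exact: iF.
Qed.

(** An embedding [f] of [T] is precomposed with a self-injection of [T] avoiding the finite preimage
    of [F]. It serves to show that a small set remains small after adding finitely many points. *)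
Lemma card_le_setU_finite (T U : Type) (A F : set U) :
  infinite_set [set: T] -> finite_set F -> [set: T] #<= A `|` F -> [set: T] #<= A.
Proof.
move=> infT finF; elim/Ppointed: U => U in A F finF *.
  by rewrite !emptyE.
move=> /pcard_leP[f].
have [|h hinj hF] := @infinite_avoid T (f @^-1` F) infT.
  apply: card_le_finite finF; apply/pcard_leP/injfunPex; exists f => // x y _ _.
  by apply: inj; rewrite inE.
apply/pcard_leP/injfunPex; exists (f \o h) => [x _|x y _ _] /=.
  by have [//|/hF] := 'funS_f (I : [set: T] (h x)).
by move=> /inj e; apply: hinj; apply: e; rewrite inE.
Qed.

Lemma tget_finite (S : Type) (X : S -> Type) J (x : tup X J) :
  finite_set [set y : {s : S & X s} | exists i : var J (projT1 y),
    tget i x = projT2 y].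
Proof.
elim: J x => [|s0 J IH] x.
  by apply: (@sub_finite_set _ _ set0) => // -[s y] /= [i]; inversion i.
apply: (@sub_finite_set _ _ ([set existT _ s0 x.1] `|`
  [set y | exists i : var J (projT1 y), tget i x.2 = projT2 y])).
  move=> [s y] /= [i]; move: s i y; apply: var_cons => /= [y <-|s i y <-].
    by left.
  by right; exists i.
by rewrite finite_setU; split=> //; exact: IH.
Qed.

Section Homogeneity.
Variables (kappa : Type) (L : lang) (C : structure L).
Hypothesis C_monster : monster kappa C.

(** There are infinitely many formulas: the iterated implications [f n] are told apart by [depth]. A
    finite [kappa] would thus embed into the formulas, against the first clause of [monster]. *)
Lemma infinite_kappa : infinite_set [set: kappa].
Proof.
case: C_monster => nle _ _ /finite_set_countable cK; apply: nle.
apply: card_le_trans cK _.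
pose f := fix f n : formula (L := L) [::] :=
  if n is n'.+1 then Imp Bot (f n') else Bot.
pose depth := fix depth G (phi : formula (L := L) G) : nat :=
  if phi is Imp _ q then (depth _ q).+1 else 0.
have depth_f n : depth _ (f n) = n by elim: n => //= n ->.
suff [g] : $|{injfun [set: nat] >-> [set: {G : seq (lsort L) & formula G}]}|.
  exact: inj_card_le g.
apply/injfunPex; exists (fun n => existT (@formula L) [::] (f n)) => // m n _ _ mn.
by have := congr1 (fun p => depth _ (projT2 p)) mn; rewrite /= !depth_f.
Qed.

Lemma small_setU (K : sset C) J (x : tup C J) : small kappa K ->
  small kappa (fun s => [set y | K s y \/ exists i : var J s, tget i x = y]).
Proof.
move=> Ksm; apply: contra_not Ksm => le.
apply: card_le_setU_finite (tget_finite x) _; first exact: infinite_kappa.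
apply: card_le_trans le _; apply: subset_card_le => -[s y] /=; by [].
Qed.

Lemma eval_automorphism (g : forall s, C s -> C s) G s (t : term G s) v :
  automorphism g -> Defs.eval t (tmap g v) = g s (Defs.eval t v).
Proof.
move=> [_ gf _]; elim: t => [s' x|f ts IH] /=; first by rewrite tget_tmap.
by rewrite gf; congr fint; apply: eq_tget => s' y; rewrite tget_tmap !tget_ttab.
Qed.

Lemma sat_automorphism (g : forall s, C s -> C s) G (phi : formula G) v :
  automorphism g -> sat C phi (tmap g v) <-> sat C phi v.
Proof.
move=> gA; elim: phi v => {G} [|G s t u|G R ts|G p IHp q IHq|G s p IHp] v //=.
- rewrite !eval_automorphism //.
  have [gb _ _] := gA; have ginj := bij_inj (gb s).
  by split=> [/ginj//|->].
- have [_ _ gR] := gA; apply: iff_trans (gR R _); rewrite tmap_comp.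
  rewrite (@eq_tmap _ _ _ _ (fun s t => g s (Defs.eval t v))) // => s t.
  exact: eval_automorphism.
- by rewrite IHp IHq.
- have [gb _ _] := gA; have [g' gK g'K] := gb s.
  split=> h a; first by apply/IHp; exact: (h (g s a)).
  by rewrite -(g'K a); apply/(IHp ((g' a, v) : tup C (s :: G))); exact: h.
Qed.

Lemma Kdef_eq_var (K : sset C) J s (i j : var J s) :
  Kdef K [set x : tup C J | tget i x = tget j x].
Proof.
apply: def_Kdef; exists (Eq (Var i) (Var j)) => -[] x /=; exact: iff_refl.
Qed.

Lemma Kdef_eq_param (K : sset C) J s (i : var J s) a : K s a ->
  Kdef K [set x : tup C J | tget i x = a].
Proof.
move=> Ka.
apply: (@Kdef_intro _ _ _ J [:: s] (fun x k => tget i x = k.1)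
  (exist _ a Ka, tt)).
have v0 := varmap_id (fun _ : unit => C) (J ++ [:: s]).
have [r rE] := varmap_tfst v0; have [t tE] := varmap_tsnd v0.
exists (Eq (Var (tget i r)) (Var t.1)) => -[] x /=.
by have /= -> := rE tt x; have /= -> := tE tt x; rewrite /vsub tget_tmap.
Qed.

(** The map fixing [K] and sending the coordinates of [x] to those of [y] is elementary, since [x]
    and [y] have the same type over [K]; its domain is still small, so strong homogeneity extends
    it. *)
Lemma homogeneous (K : sset C) J (x y : tup C J) : small kappa K ->
  (forall X, Kdef K X -> X x -> X y) ->
  exists g, [/\ automorphism g, forall s a, K s a -> g s a = a & tmap g x = y].
Proof.
move=> Ksm xy.
have xyE X : Kdef K X -> X x <-> X y.
  move=> dX; split; first exact: xy.
  by move=> Xy; apply: contrapT => nXx; exact: (xy _ (Kdef_setC dX)).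
pose A := (fun s => [set y | K s y \/ exists i : var J s, tget i x = y]) : sset C.
have Asm : small kappa A by exact: small_setU.
(* A position of [a] in [x] is chosen arbitrarily. Neither this choice nor an overlap of [x] with
   [K] matters, because equality of two coordinates, or of a coordinate with an element of [K], is a
   [K]-definable condition that passes from [x] to [y]. *)
pose f s (a : sub A s) : C s :=
  if pselect (exists i : var J s, tget i x = sval a) is left e
  then tget (sval (cid e)) y else sval a.
(* A tuple of [A] uses finitely many elements of [K], so it is a renaming of [(x, k)]; its image is
   the same renaming of [(y, k)], and elementarity reduces to one formula over [k]. *)
have Atup G (v : tup (sub A) G) : exists G0 (k : tup (sub K) G0)
    (r : tup (var (J ++ G0)) G),
    inc v = vsub r (tcat x (inc k)) /\ tmap f v = vsub r (tcat y (inc k)).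
  elim: G v => [|s G IH] v; first by exists [::], tt, tt.
  case: v => -[a Aa] v; have [G0 [k [r [vr fvr]]]] := IH v.
  rewrite /inc /= -/(inc v) vr fvr /f /=; case: pselect => [e|ne] /=.
    exists G0, k, (tget (sval (cid e)) (tfst (vid (J ++ G0))), r).
    rewrite /vsub /= -!/(vsub _ _) !tget_vsub !vsub_tfst !vsub_id !tfstK.
    by split=> //; congr pair; case: cid.
  have Ka : K s a by case: Aa => // -[i ix]; case: ne; exists i.
  pose k' : tup (sub K) (s :: G0) := (exist _ a Ka, k).
  pose V := vid (J ++ s :: G0); pose t : tup _ ([:: s] ++ G0) := tsnd V.
  have VE z : vsub (tsnd V) (tcat z (inc k')) = inc k'.
    by rewrite vsub_tsnd vsub_id tsndK.
  have E z : vsub (vsub r (tcat (tfst V) (tsnd t))) (tcat z (inc k')) =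
      vsub r (tcat z (inc k)).
    rewrite vsub_comp vsub_tcat vsub_tfst vsub_id tfstK.
    by rewrite (vsub_tsnd (J := [:: s])) VE.
  exists (s :: G0), k', ((tsnd V).1, vsub r (tcat (tfst V) (tsnd t))).
  by split; congr pair; rewrite -?E //; exact: esym (congr1 fst (VE _)).
have [_ _ hom] := C_monster.
have [|g gA gf] := hom A Asm f.
  move=> G phi v; have [G0 [k [r [-> ->]]]] := Atup G v.
  rewrite -!sat_rename.
  pose X : set (tup C J) := fun x => sat C (rename phi r) (tcat x (inc k)).
  by apply: (xyE X); exists G0, (rename phi r), k.
have fx s (i : var J s) (Ai : A s (tget i x)) : f s (exist _ _ Ai) = tget i y.
  rewrite /f /=; case: pselect => [e|[]]; last by exists i.
  case: (cid e) => j xj /=.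
  by apply: (xy _ (Kdef_eq_var K j i)); exact: xj.
exists g; split=> // [s a Ka|].
  have Aa : A s a by left.
  rewrite (gf s (exist _ a Aa)) /f; case: pselect => //= e.
  case: (cid e) => j ja /=.
  by apply: (xy _ (Kdef_eq_param j Ka)); exact: ja.
apply: eq_tget => s i; rewrite tget_tmap.
have Ai : A s (tget i x) by right; exists i.
by rewrite (gf s (exist _ _ Ai)) fx.
Qed.

End Homogeneity.

(* False when [T] is empty, even if [O = set0]. *)
Definition bounded (n : nat) (T : Type) (O : set T) : Prop :=
  exists f : nat -> T, O `<=` f @` `I_n.

Lemma bounded_card n (T : Type) (O : set T) : bounded n O -> O #<= `I_n.
Proof.
by case=> f Of; apply: card_le_trans (subset_card_le Of) (card_image_le _ _).
Qed.

Lemma card_bounded n (T : Type) (O : set T) (x0 : T) : O #<= `I_n -> bounded n O.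
Proof.
elim/Ppointed: T => T in O x0 *; first by have := no x0.
by case/pcard_surjP => f /= Of; exists f.
Qed.

Lemma bounded_pack n L (C : structure L) J (O : set (tup C J)) x0 :
  O x0 -> bounded n O ->
  exists2 f : nat -> tup C J, (forall i, O (f i)) &
    forall x, O x <-> tmem x (pack n f).
Proof.
move=> Ox0 [f Of].
(* Values falling outside [O] are replaced by [x0], so that the list has exactly the members of
   [O]. *)
exists (fun i => if pselect (O (f i)) then f i else x0) => [i|x].
  by case: pselect.
rewrite tmem_pack; split=> [Ox|[i _ <-]]; last by case: pselect.
by have [i /= i_n fi] := Of x Ox; exists i => //; case: pselect; rewrite fi.
Qed.

Lemma bounded_tmem n L (C : structure L) J (z : tup C (pow n J)) (x0 : tup C J) :
  bounded n [set x : tup C J | tmem x z].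
Proof.
have [f fP] := tmem_enum z x0; exists f => x /fP[i i_n <-].
by exists i.
Qed.

Lemma bounded_mul m n L (C : structure L) J J' (X : set (tup C J))
    (Y : set (tup C J')) : bounded m X -> bounded n Y ->
  bounded (m * n) [set w : tup C (J ++ J') | X (tfst w) /\ Y (tsnd w)].
Proof.
case=> f Xf [h Yh]; exists (fun i => tcat (f (i %/ n)) (h (i %% n))) => w [].
move=> /Xf[i /= i_m fi] /Yh[j /= j_n hj]; exists (i * n + j)%N => /=.
  by rewrite (leq_trans (n := (i * n + n)%N)) ?ltn_add2l // -mulSnr leq_mul2r i_m orbT.
have n0 : (0 < n)%N by exact: leq_ltn_trans j_n.
by rewrite divnMDl // divn_small // addn0 modnMDl modn_small // fi hj tcatK.
Qed.

Section AutInvariance.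
Variables (L : lang) (C : structure L) (K : sset C).
Arguments K : clear implicits.

Lemma sub_acl (s : lsort L) : K s `<=` @acl L C K s.
Proof.
move=> a Ka; exists [:: s], (Eq (Var (VZ s [:: s])) (Var (VS s (VZ s [::])))).
exists (exist _ a Ka, tt); split=> //=.
by apply: (@sub_finite_set _ _ [set a]) => // x /= ->.
Qed.

(** The parameters from [K] form a tuple of [A] fixed by [sigma]. General [A] and [B] are kept
    because the lemma serves both [G] and the automorphism group of a fixed set over [K]. *)
Lemma aut_Kdef (A B : sset C) (sigma : aut A B) J (X : set (tup C J)) :
  (forall s, K s `<=` A s) -> (forall s, K s `<=` B s) -> Kdef K X ->
  forall u : tup (sub A) J, X (inc u) <-> X (inc (tmap sigma u)).
Proof.
move=> KA KB [G [phi [k phiP]]] u.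
pose k' : tup (sub A) G := tmap (fun s (x : sub K s) =>
  exist _ (sval x) (KA s _ (svalP x)) : sub A s) k.
have k'E : inc k' = inc k by rewrite /inc tmap_comp.
have sk' : tmap sigma k' = k'.
  rewrite tmap_comp; apply: eq_tmap => s x.
  by apply: aut_fix; apply: KB; exact: (svalP x).
have := aut_elem sigma phi (tcat u k').
have E J' (v : tup (sub A) J') :
    tmap (fun s x => sval (sigma s x)) v = inc (tmap sigma v).
  by rewrite /inc tmap_comp.
by rewrite tmap_tcat !E sk' inc_tcat k'E !phiP.
Qed.

End AutInvariance.

Section Orbits.
Variables (kappa : Type) (L : lang) (C : structure L) (K : sset C).
Hypotheses (C_monster : monster kappa C) (K_small : small kappa K)
  (K_dcl : definably_closed K).
Arguments K : clear implicits.
Local Notation A := (@acl L C K).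
Local Notation G := (galois_group K).

Lemma sub_dcl (s : lsort L) : K s `<=` @dcl L C K s.
Proof. by rewrite K_dcl. Qed.

Lemma galois_fix (g : G) s (x : sub A s) : K s (sval x) -> g s x = x.
Proof. by move=> Kx; apply: aut_fix; exact: sub_dcl. Qed.

Lemma galois_Kdef (g : G) J (X : set (tup C J)) (u : tup (sub A) J) :
  Kdef K X -> X (inc u) <-> X (inc (tmap g u)).
Proof. move=> dX; apply: aut_Kdef dX _ => s; [exact: sub_acl|exact: sub_dcl]. Qed.

Lemma automorphism_acl (g : forall s, C s -> C s) :
  automorphism g -> (forall s a, K s a -> g s a = a) ->
  forall s (x : C s), A x -> A (g s x).
Proof.
move=> gA gK s x [G0 [phi [b [phix finphi]]]]; exists G0, phi, b; split=> //.
have -> : inc b = tmap g (inc b).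
  by rewrite /inc tmap_comp; apply: eq_tmap => s' y; rewrite gK //; exact: svalP.
exact/(sat_automorphism phi ((x, inc b) : tup C (s :: G0)) gA).
Qed.

Lemma restrict_automorphism (g : forall s, C s -> C s) :
  automorphism g -> (forall s a, K s a -> g s a = a) ->
  exists h : G, forall s (x : sub A s), sval (h s x) = g s (sval x).
Proof.
move=> gA gK; have [gb gf gR] := gA.
have ex_g' s : exists g' : C s -> C s, cancel (g s) g' /\ cancel g' (g s).
  by have [g' ? ?] := gb s; exists g'.
pose g' s := sval (cid (ex_g' s)).
have gK' s : cancel (g s) (g' s) by rewrite /g'; case: (cid _) => ? [].
have g'K s : cancel (g' s) (g s) by rewrite /g'; case: (cid _) => ? [].
have tg'K J (v : tup C J) : tmap g (tmap g' v) = v.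
  by rewrite tmap_comp -[RHS]tmap_id; exact: eq_tmap.
have g'A : automorphism g'.
  split=> [s|f v|R v]; first by exists (g s).
    by apply: (can_inj (gK' _)); rewrite g'K gf tg'K.
  by rewrite -gR tg'K.
have g'fix s a : K s a -> g' s a = a by move=> Ka; rewrite -{1}(gK s a) ?gK'.
pose h s (x : sub A s) : sub A s :=
  exist _ (g s (sval x)) (automorphism_acl gA gK (svalP x)).
pose h' s (x : sub A s) : sub A s :=
  exist _ (g' s (sval x)) (automorphism_acl g'A g'fix (svalP x)).
have hK s : cancel (@h s) (@h' s).
  by case=> x Ax; apply: eq_exist; rewrite /= gK'.
have h'K s : cancel (@h' s) (@h s).
  by case=> x Ax; apply: eq_exist; rewrite /= g'K.
have hE : elementary_map (fun s x => sval (@h s x)).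
  move=> G0 phi v; rewrite -[tmap _ v]/(tmap (fun s x => g s (sval x)) v).
  by rewrite -tmap_comp sat_automorphism.
have hfix s (x : sub A s) : @dcl L C K s (sval x) -> h s x = x.
  by rewrite K_dcl; case: x => x Ax /= Kx; apply: eq_exist; exact (gK s x Kx).
by exists (Aut hK h'K hE hfix).
Qed.

Lemma galois_lift J (u : tup (sub A) J) (y : tup C J) :
  (forall X, Kdef K X -> X (inc u) -> X y) -> exists g : G, y = inc (tmap g u).
Proof.
move=> uy; have [g [gA gK <-]] := homogeneous C_monster K_small uy.
have [h hE] := restrict_automorphism gA gK; exists h.
by rewrite /inc !tmap_comp; apply: eq_tmap => s x; rewrite hE.
Qed.

(** Finitely many [K]-definable sets suffice to cut a finite one down to the points with the same
    type over [K] as [inc u], and these are the conjugates by [galois_lift]. *)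
Lemma orbit_Kdef J (u : tup (sub A) J) : exists X, [/\ Kdef K X, finite_set X &
  forall x, X x <-> exists g : G, x = inc (tmap g u)].
Proof.
have [X [dX finX Xu]] := acl_finite_Kdef u.
have [Z [dZ Zu ZX]] : exists Z, [/\ Kdef K Z, Z (inc u) & forall x, X x -> Z x ->
    forall Y, Kdef K Y -> Y (inc u) -> Y x].
  have [n /(card_bounded (inc u))[f Xf]] : exists n, X #<= `I_n by exact/finite_set_leP.
  suff [Z [dZ Zu Zf]] : exists Z, [/\ Kdef K Z, Z (inc u) & forall i, (i < n)%N ->
      Z (f i) -> forall Y, Kdef K Y -> Y (inc u) -> Y (f i)].
    by exists Z; split=> // x /Xf[i /= i_n <-]; exact: Zf.
  elim: n {Xf} => [|n [Z [dZ Zu Zf]]].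
    exists setT; split=> //.
    by exists [::], (Imp Bot Bot), tt => x; split=> // _.
  (* A point [f n] that some [K]-definable set around [inc u] omits is cut away; otherwise it
     satisfies everything that [inc u] does and may stay. *)
  have [[Y [dY Yu nYn]]|nY] :=
    pselect (exists Y, [/\ Kdef K Y, Y (inc u) & ~ Y (f n)]).
    exists (Z `&` Y); split=> //; first exact: Kdef_setI.
    move=> i; rewrite ltnS leq_eqVlt => /predU1P[-> []//|i_n [Zi _]].
    exact: Zf.
  exists Z; split=> // i; rewrite ltnS leq_eqVlt => /predU1P[-> Zn|]; last exact: Zf.
  by move=> Y dY Yu; apply: contrapT => nYn; apply: nY; exists Y.
exists (X `&` Z); split; [exact: Kdef_setI|exact: sub_finite_set finX|] => x.
split=> [[Xx Zx]|[g ->]]; last first.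
  by split; [apply/(galois_Kdef g u dX)|apply/(galois_Kdef g u dZ)].
by apply: galois_lift => Y dY Yu; exact: ZX Xx Zx Y dY Yu.
Qed.

End Orbits.

Lemma tup_of_nat (S : Type) (X : S -> Type) n (f : nat -> {s : S & X s}) :
  exists J (t : tup X J), forall i, (i < n)%N ->
    exists v : var J (projT1 (f i)), tget v t = projT2 (f i).
Proof.
elim: n f => [|n IH] f; first by exists [::], tt.
have [J [t tP]] := IH (fun i => f i.+1).
exists (projT1 (f 0) :: J), (projT2 (f 0), t) => -[_|i i_n].
  by exists (VZ _ _).
by have [v vP] := tP i i_n; exists (VS _ v).
Qed.

Section Codes.
Variables (L : lang) (C : structure L) (K : sset C).
Arguments K : clear implicits.
Implicit Types (J : seq (lsort L)).

Lemma Kdef_image J J' (chi : formula (J ++ J')) (X : set (tup C J)) :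
  Kdef K X -> Kdef K [set y | exists2 x, X x & sat C chi (tcat x y)].
Proof.
case=> G [phi [k phiP]].
apply: Kdef_ext (@Kdef_intro _ _ _ J' G (fun y k => exists x,
  sat C phi (tcat x k) /\ sat C chi (tcat x y)) k _) => [y|].
  by split=> [[x []]|[x]] ? ?; exists x => //; rewrite ?phiP // -phiP.
have v0 := varmap_id (fun _ : unit => C) (J ++ J' ++ G).
apply: (@udef_ex _ _ _ J (J' ++ G) (fun _ x w =>
  sat C phi (tcat x (tsnd w)) /\ sat C chi (tcat x (tfst w)))).
apply: udef_and.
  apply: udef_varmap (udef_formula _ phi) (varmap_tcat (varmap_tfst v0) _).
  exact: varmap_tsnd (varmap_tsnd v0).
apply: udef_varmap (udef_formula _ chi) (varmap_tcat (varmap_tfst v0) _).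
exact: varmap_tfst (varmap_tsnd v0).
Qed.

Lemma Kdef_set1 J (c : tup C J) s (i : var J s) :
  Kdef K [set c] -> dcl K (tget i c).
Proof.
move=> dc.
have [r rE] := varmap_tfst (varmap_id (fun _ : unit => C) (J ++ [:: s])).
have [t tE] := varmap_tsnd (varmap_id (fun _ : unit => C) (J ++ [:: s])).
have [G [phi [k phiP]]] := Kdef_image (Eq (Var (tget i r)) (Var t.1)) dc.
exists G, phi, k; apply/seteqP; split=> [y|y ->] /=.
  move=> yk; have /phiP[_ -> /=] : sat C phi (tcat ((y, tt) : tup C [:: s]) (inc k)).
    exact: yk.
  pose v := tcat c ((y, tt) : tup C [:: s]).
  have rv := rE tt v; have tv : tget t.1 v = y.
    by have := congr1 fst (tE tt v); rewrite /v tsndK.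
  by rewrite -/v tv tget_vsub -rv tfstK.
suff /phiP : [set y | exists2 x, [set c] x & sat C (Eq (Var (tget i r)) (Var t.1))
    (tcat x y)] ((tget i c, tt) : tup C [:: s]) by [].
exists c => //=.
pose v := tcat c ((tget i c, tt) : tup C [:: s]).
have rv := rE tt v; have tv : tget t.1 v = tget i c.
  by have := congr1 fst (tE tt v); rewrite /v tsndK.
by rewrite -/v tv tget_vsub -rv tfstK.
Qed.

Section OneCode.
Variables (n : nat) (J J' : seq (lsort L)) (chi : formula (pow n J ++ J')).
Hypothesis chi_fun : forall z : tup C (pow n J), exists! c, sat C chi (tcat z c).
Hypothesis chi_eq : forall z z' : tup C (pow n J),
  (forall x, tmem x z <-> tmem x z') <->
  exists2 c, sat C chi (tcat z c) & sat C chi (tcat z' c).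

Lemma chi_unique z c c' : sat C chi (tcat z c) -> sat C chi (tcat z c') -> c = c'.
Proof. by have [d [_ dP]] := chi_fun z; move=> /dP <- /dP <-. Qed.

(** The set and its code define each other: [c] is the common value of [chi] on all lists of the
    set, and the set is the union of the lists with value [c]. Since [K] is definably closed,
    definability of [c] over [K] means membership in [K]. *)
Lemma code_in z c : definably_closed K -> sat C chi (tcat z c) ->
  Kdef K [set x | tmem x z] <-> forall s (i : var J' s), K s (tget i c).
Proof.
move=> K_dcl zc; split=> [[G [phi [k phiP]]] s i|cK].
  have <- := K_dcl s; apply: Kdef_set1.
  (* The list [z] need not be definable over [K], but the collection of all lists of the same set
     is; [chi] sends it to the single point [c]. *)
  have dZ : Kdef K [set z' : tup C (pow n J) | forall x, sat C phi (tcat x (inc k)) <-> tmem x z'].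
    pose R (z' : tup C (pow n J)) k := forall x : tup C J, sat C phi (tcat x k) <-> tmem x z'.
    apply: (@Kdef_intro _ _ _ (pow n J) G R k).
    apply: (@udef_all _ _ _ J (pow n J ++ G) (fun _ x w =>
      sat C phi (tcat x (tsnd w)) <-> tmem x (tfst w))).
    have v0 := varmap_id (fun _ : unit => C) (J ++ pow n J ++ G).
    apply: udef_iff.
      apply: udef_varmap (udef_formula _ phi) (varmap_tcat (varmap_tfst v0) _).
      exact: varmap_tsnd (varmap_tsnd v0).
    apply: (udef_varmap2 (R := fun _ u v => tmem u v)) (varmap_tfst v0) _.
      exact: udef_tmem.
    exact: varmap_tfst (varmap_tsnd v0).
  apply: Kdef_ext (Kdef_image chi dZ) => c'; split=> [[z' zz' z'c']|->].
    apply: (@chi_unique z') => //.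
    have /chi_eq[d zd z'd] : forall x, tmem x z <-> tmem x z'.
      by move=> x; rewrite -zz' -phiP.
    by rewrite -(chi_unique zd zc).
  by exists z => // x; rewrite -phiP.
have [k kc] := tup_inc cK; subst c.
have : Kdef K [set x | exists z' : tup C (pow n J),
    sat C chi (tcat z' (inc k)) /\ tmem x z'].
  apply: (@Kdef_intro _ _ _ J J' (fun x c => exists z' : tup C (pow n J),
    sat C chi (tcat z' c) /\ tmem x z') k).
  apply: (@udef_ex _ _ _ (pow n J) (J ++ J') (fun _ z' w =>
    sat C chi (tcat z' (tsnd w)) /\ tmem (tfst w) z')).
  have v0 := varmap_id (fun _ : unit => C) (pow n J ++ J ++ J').
  apply: udef_and.
    apply: udef_varmap (udef_formula _ chi) (varmap_tcat (varmap_tfst v0) _).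
    exact: varmap_tsnd (varmap_tsnd v0).
  apply: (udef_varmap2 (R := fun _ u v => tmem u v)) _ (varmap_tfst v0).
    exact: udef_tmem.
  exact: varmap_tfst (varmap_tsnd v0).
apply: Kdef_ext => x; split=> [[z' [z'c xz']]|xz]; last by exists z.
have /chi_eq e : exists2 c, sat C chi (tcat z c) & sat C chi (tcat z' c)
  by exists (inc k).
by rewrite /= e.
Qed.

End OneCode.
End Codes.

(** * The Galois correspondence *)

Section Galois.
Variables (kappa : Type) (L : lang) (T : set (sentence L)) (C : structure L).
Hypotheses (T_uei : uniform_elimination_of_imaginaries T) (C_models : models T C)
  (C_monster : monster kappa C).
Variable K : sset C.
Hypotheses (K_small : small kappa K) (K_dcl : definably_closed K).
Arguments K : clear implicits.
Local Notation A := (@acl L C K).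
Local Notation G := (galois_group K).
Local Open Scope group_scope.

Lemma tmapM (g h : G) J (u : tup (sub A) J) : tmap (g * h : G)%g u = tmap g (tmap h u).
Proof. by rewrite tmap_comp. Qed.

Lemma tmap1 J (u : tup (sub A) J) : tmap (1 : G)%g u = u.
Proof. exact: tmap_id. Qed.

Lemma tmapVK (g : G) J (u : tup (sub A) J) : tmap (g^-1 : G)%g (tmap g u) = u.
Proof. by rewrite -tmapM mulVg tmap1. Qed.

Lemma tmapKV (g : G) J (u : tup (sub A) J) : tmap g (tmap (g^-1 : G)%g u) = u.
Proof. by rewrite -tmapM mulgV tmap1. Qed.

(** Openness at [1] gives a finite [F] whose pointwise stabilizer lies in [H], and [f] lists [F].
    Then [g] preserves the [H]-orbit of [f] exactly when it is in [H], and preserving that orbit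
    means fixing its code. *)
Lemma stabilizer_code (H : set G) : open_normal H ->
  exists J (c : tup (sub A) J), forall g : G, H g <-> tmap g c = c.
Proof.
move=> [oH [H1 HM HV _]].
have [F finF FH] := oH 1 H1.
have [Jf [f fF]] : exists J (f : tup (sub A) J), forall x, F x ->
    exists v : var J (projT1 x), tget v f = projT2 x.
  have [[x0 Fx0]|F0] := pselect (exists x, F x); last first.
    by exists [::], tt => x Fx; case: F0; exists x.
  have [n /(card_bounded x0)[e Fe]] : exists n, F #<= `I_n by exact/finite_set_leP.
  have [J [t tP]] := tup_of_nat n e; exists J, t => x /Fe[i /= i_n <-].
  exact: tP.
have fH (g : G) : tmap g f = f -> H g.
  move=> gf; apply: FH => x /fF[v] <-.
  by rewrite -[LHS](@tget_tmap _ _ _ g) gf.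
pose O := [set x | exists2 h, H h & x = inc (tmap (h : G) f)].
have [n bO] : exists n, bounded n O.
  have [X [_ finX XO]] := orbit_Kdef C_monster K_small K_dcl f.
  have [n Xn] : exists n, X #<= `I_n by exact/finite_set_leP.
  exists n; apply: card_bounded (inc f) _; apply: card_le_trans Xn.
  by apply: subset_card_le => x [h _ ->]; apply/XO; exists h.
have Of : O (inc f) by exists 1 => //; rewrite tmap1.
have [e eO Oe] := bounded_pack Of bO.
have /choice[h hP] : forall i, exists h : G, H h /\ e i = inc (tmap h f).
  by move=> i; have [h Hh he] := eO i; exists h.
pose z := pack n (fun i => tmap (h i) f).
have ze : inc z = pack n e.
  rewrite /z /inc tmap_pack; congr pack; apply/funext => i.
  by have [_ ->] := hP i.
have [J' [chi chiP]] := set_code n Jf T_uei.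
have [chi_fun chi_eq] := chiP C C_models.
have [c0 [zc _]] := chi_fun (inc z).
(* The code is algebraic: [z] lies in a finite [K]-definable set, and the image of this set under
   the functional [chi] is finite and [K]-definable. *)
have [c cc0] : exists c : tup (sub A) J', inc c = c0.
  have [X [dX finX Xz]] := acl_finite_Kdef z.
  apply: finite_Kdef_acl (Kdef_image chi dX) _ _; last by exists (inc z).
  pose cd x := sval (cid (chi_fun x)).
  apply: sub_finite_set (finite_image cd finX) => y [x Xx xy].
  exists x => //; rewrite /cd; case: cid => d [xd dP] /=; exact: dP.
subst c0; exists J', c => g.
have gz : sat C chi (tcat (inc (tmap g z)) (inc (tmap g c))).
  have := aut_elem g chi (tcat z c); rewrite inc_tcat => /iffLR/(_ zc).
  by rewrite -inc_tcat -tmap_tcat /inc tmap_comp.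
have mem_gz x : tmem x (inc (tmap g z)) <-> exists2 h : G, H h & x = inc (tmap (g * h : G)%g f).
  rewrite {1}/z tmap_pack /inc tmap_pack tmem_pack; split=> [[i i_n <-]|[k Hk ->]].
    by exists (h i); rewrite ?tmapM //; have [] := hP i.
  have : O (inc (tmap k f)) by exists k.
  rewrite Oe tmem_pack => -[i i_n]; have [_ ->] := hP i; move=> /inc_inj E.
  by exists i; rewrite // -[LHS]/(inc _) tmapM E.
have mem_z x : tmem x (inc z) <-> exists2 h : G, H h & x = inc (tmap h f).
  by rewrite ze -Oe.
split=> [Hg|gc].
  apply: (@inc_inj _ _ A).
  have /chi_eq[d zd gzd] : forall x, tmem x (inc z) <-> tmem x (inc (tmap g z)).
    move=> x; rewrite mem_z mem_gz; split=> -[k Hk ->].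
      by exists (g^-1 * k); rewrite ?mulVKg //; apply: HM => //; exact: HV.
    by exists (g * k) => //; exact: HM.
  by rewrite (chi_unique chi_fun zc zd) (chi_unique chi_fun gz gzd).
(* As [g] preserves the orbit, [g f = k f] for some [k] in [H]; then [k^-1 g] fixes [f], hence is in
   [H]. *)
have /chi_eq/(_ (inc (tmap g f)))[_] :
    exists2 d, sat C chi (tcat (inc z) d) & sat C chi (tcat (inc (tmap g z)) d).
  by exists (inc c) => //; rewrite -gc.
rewrite mem_z mem_gz => -[].
  by exists 1 => //; rewrite mulg1.
move=> k Hk /inc_inj gk.
rewrite -(mulVKg k g); apply: HM => //; apply: fH.
by rewrite tmapM gk tmapVK.
Qed.

End Galois.

(** By pigeonhole, this turns the equality of cardinalities in [FK] into faithfulness of the action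
    on [S_J(L)]. *)
Lemma range_finite_inj (T U : Type) (F : T -> U) :
  finite_set [set: T] -> range F #= [set: T] -> injective F.
Proof.
elim/Pchoice: T => T in F *; move=> finT FT a b Fab; apply: contrapT => ab.
have sF : range F `<=` F @` ([set: T] `\` [set a]).
  move=> _ [x _ <-]; have [->|xa] := pselect (x = a); last by exists x.
  by exists b => //; split=> // ba; apply: ab.
have [m Dm] : exists m, [set: T] `\` [set a] #= `I_m.
  exact/finite_setP/finite_setD.
have Tm : [set: T] #<= `I_m.
  have /card_eqPle[_ TF] := FT; have /card_eqPle[D_m _] := Dm.
  apply: card_le_trans TF (card_le_trans (subset_card_le sF) _).
  exact: card_le_trans (card_image_le _ _) D_m.
have := geq_card_fset_set Tm; rewrite -(card_fset_set Dm) fset_setD1 //.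
by rewrite [in leqLHS](cardfsD1 a) in_fset_set // in_setT ltnn.
Qed.

(** * Elements of [G] and automorphisms of the fixed set of [H] *)

Section Restriction.
Variables (kappa : Type) (L : lang) (C : structure L).
Hypothesis C_monster : monster kappa C.
Variable K : sset C.
Hypotheses (K_small : small kappa K) (K_dcl : definably_closed K).
Arguments K : clear implicits.
Local Notation A := (@acl L C K).
Local Notation G := (galois_group K).
Local Open Scope group_scope.
Variable H : set G.
Local Notation Fx := (@fixed_set L C K H).

Lemma fixed_acl s (x : C s) : Fx x -> A x.
Proof. by move=> [y _ <-]; exact: svalP. Qed.

Lemma sub_fixed (s : lsort L) : K s `<=` @fixed_set L C K H s.
Proof.
move=> a Ka; exists (exist _ a (sub_acl Ka)) => // g _.
exact: galois_fix.
Qed.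

Lemma tup_fixed J (c : tup (sub A) J) :
  (forall g : G, H g -> tmap g c = c) -> exists c' : tup (sub Fx) J, inc c' = inc c.
Proof.
move=> cH; apply: tup_inc => s i; rewrite /inc tget_tmap.
exists (tget i c) => // g Hg.
by rewrite -[in RHS](cH g Hg) tget_tmap.
Qed.

Lemma fixed_tup J (v : tup (sub Fx) J) :
  exists2 w : tup (sub A) J, inc w = inc v & forall g : G, H g -> tmap g w = w.
Proof.
have [w wv] : exists w : tup (sub A) J, inc w = inc v.
  by apply: tup_inc => s i; apply: fixed_acl; exact: inc_in.
exists w => // g Hg; apply: eq_tget => s i; rewrite tget_tmap.
have [y yH yw] := inc_in v i.
suff -> : tget i w = y by exact: yH.
move: yw; rewrite -wv /inc tget_tmap.
case: y {yH} (tget i w) => y Ay [x Ax] /= yx; exact: eq_exist.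
Qed.

(** The two maps act on different subtypes, so that [sigma] being the restriction of [g] is tested
    on ambient tuples through [inc]. *)
Definition restricts (sigma : aut Fx K) (g : G) : Prop :=
  forall J (v : tup (sub Fx) J) (w : tup (sub A) J),
    inc v = inc w -> inc (tmap sigma v) = inc (tmap g w).

Lemma restrict_aut (g : G) : normal_subgroup H ->
  exists sigma, restricts sigma g.
Proof.
move=> [_ _ _ HJ].
pose r (k : G) s (x : sub Fx s) : C s := sval (k s (exist _ (sval x) (fixed_acl (svalP x)))).
have rE (k : G) s (x : sub Fx s) (y : sub A s) : sval x = sval y ->
    r k s x = sval (k s y).
  by move=> xy; rewrite /r; congr (sval (k s _)); case: y xy => y ? /= xy; exact: eq_exist.
have rF (k : G) s (x : sub Fx s) : Fx (r k s x).
  case: x => x Fxx; have [y yH yx] := Fxx.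
  rewrite (rE k _ _ y) /= ?yx //; exists (k s y) => // h Hh.
  (* Normality keeps the fixed set stable: [h k y = k (k^-1 h k) y = k y]. *)
  have := yH _ (HJ k^-1 h Hh); rewrite invgK => e.
  have E : k * (k^-1 * h * k) = h * k by rewrite !mulgA mulgV mul1g.
  by rewrite -[in RHS]e -[RHS]/((k * (k^-1 * h * k)) s y) E.
pose f k s (x : sub Fx s) : sub Fx s := exist _ (r k s x) (rF k s x).
have fK (k : G) s : cancel (f k s) (f k^-1 s).
  move=> x; case: x => x Fxx; have [y yH yx] := Fxx.
  apply: eq_exist; rewrite (rE _ _ _ (k s y)); last by rewrite /= (rE _ _ _ y).
  by rewrite -[LHS]/(sval ((k^-1 * k) s y)) mulVg.
have fE : elementary_map (fun s x => sval (f g s x)).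
  move=> J phi v; have [w wv _] := fixed_tup v.
  rewrite -wv; apply: iff_trans (aut_elem g phi w) _.
  suff -> : tmap (fun s x => sval (g s x)) w = tmap (fun s x => sval (f g s x)) v by [].
  apply: eq_tget => s i; rewrite !tget_tmap /=; apply/esym/rE.
  by have := congr1 (tget i) wv; rewrite /inc !tget_tmap.
have ff s (x : sub Fx s) : K s (sval x) -> f g s x = x.
  case: x => x Fxx /= Kx; apply: eq_exist.
  by rewrite (rE _ _ _ (exist _ x (sub_acl Kx))) //= galois_fix.
have f'K s : cancel (f g^-1 s) (f g s) by rewrite -{2}[g]invgK; exact: fK.
exists (Aut (fK g) f'K fE ff).
move=> J v w vw; apply: eq_tget => s i; rewrite /inc !tget_tmap /=; apply: rE.
by have := congr1 (tget i) vw; rewrite /inc !tget_tmap.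
Qed.

Section Stabilizer.
Variables (Jc : seq (lsort L)) (c : tup (sub A) Jc).
Hypothesis cH : forall g : G, H g <-> tmap g c = c.

(** On one finite tuple [sigma] acts as some [g], because it preserves the [K]-definable orbit. To
    get a single [g] for all tuples, [c] is appended: two lifts agreeing on [c] differ by an element
    of [H], so they agree on the whole fixed set. *)
Lemma lift_aut (sigma : aut Fx K) : exists g, restricts sigma g.
Proof.
have [c' c'c] := tup_fixed (fun g Hg => iffLR (cH g) Hg).
have lift J (v : tup (sub Fx) J) (w : tup (sub A) J) : inc v = inc w ->
    exists g : G, inc (tmap sigma v) = inc (tmap g w) /\
      inc (tmap sigma c') = inc (tmap g c).
  move=> vw; have [X [dX _ XP]] := orbit_Kdef C_monster K_small K_dcl (tcat w c).
  have Xwc : X (inc (tcat v c')).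
    by apply/XP; exists (1%g : G); rewrite tmap1 // !inc_tcat vw c'c.
  have /XP[g] := iffLR (aut_Kdef sigma sub_fixed (fun _ _ Kx => Kx) dX (tcat v c')) Xwc.
  rewrite !tmap_tcat !inc_tcat => E; exists g.
  by split; [have := congr1 (@tfst _ C J Jc) E|have := congr1 (@tsnd _ C J Jc) E];
    rewrite ?tfstK ?tsndK.
(* The empty tuple yields the reference lift, with which the lift for each [v] is compared through
   its effect on [c]. *)
have [g [_ gc]] := lift [::] tt tt erefl.
exists g => J v w vw; have [h [-> hc]] := lift J v w vw.
congr inc; move: hc; rewrite gc => /inc_inj hc.
have Hgh : H (g^-1 * h)%g by apply/cH; rewrite tmapM // -hc tmapVK.
have [w' w'v w'H] := fixed_tup v.
have ww' : w = w' by apply: (@inc_inj _ _ A); rewrite w'v.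
by have := w'H _ Hgh; rewrite -ww' => E; rewrite -[in RHS]E tmapM // tmapKV.
Qed.

Lemma restricts_inj (sigma tau : aut Fx K) (g : G) :
  restricts sigma g -> restricts tau g -> sigma = tau.
Proof.
move=> sg tg; apply: aut_ext => s x.
have [w wx _] := fixed_tup ((x, tt) : tup (sub Fx) [:: s]).
have := sg _ _ _ (esym wx); rewrite -(tg _ _ _ (esym wx)) => /(@inc_inj _ _ Fx).
by case.
Qed.

Lemma restricts_eq (sigma tau : aut Fx K) (g h : G) :
  restricts sigma g -> restricts tau h -> tmap g c = tmap h c -> sigma = tau.
Proof.
move=> sg th gh; apply: (restricts_inj sg) => J v w vw; rewrite (th _ _ _ vw).
have Hgh : H (g^-1 * h)%g by apply/cH; rewrite tmapM // -gh tmapVK.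
have [w' w'v w'H] := fixed_tup v.
have ww' : w = w' by apply: (@inc_inj _ _ A); rewrite w'v.
by have := w'H _ Hgh; rewrite -ww' => E; rewrite -[in RHS]E tmapM // tmapKV.
Qed.

(** The group of the fixed set is finite, as [sigma] is determined by its value on [c], a point of a
    finite orbit. So [FK] gives injectivity of the restriction to [J]-tuples, and [h] outside [H]
    restricts differently from [1]. *)
Lemma FK_elim J h : normal_subgroup H -> FK H J -> ~ H h ->
  exists v : tup (sub A) J, (forall g : G, H g -> tmap g v = v) /\ tmap h v <> v.
Proof.
move=> nH FKJ nHh.
have [c' c'c] := tup_fixed (fun g Hg => iffLR (cH g) Hg).
have finF : finite_set [set: aut Fx K].
  have [X [_ finX XP]] := orbit_Kdef C_monster K_small K_dcl c.
  apply: card_le_finite finX.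
  suff [k] : $|{injfun [set: aut Fx K] >-> X}| by exact: inj_card_le k.
  apply/injfunPex; exists (fun sigma : aut Fx K => inc (tmap sigma c')).
    move=> sigma _; have [g gs] := lift_aut sigma.
    by apply/XP; exists g; exact: gs.
  move=> sigma tau _ _ /= E.
  have [g gs] := lift_aut sigma; have [k kt] := lift_aut tau.
  apply: (restricts_eq gs kt).
  by move: E; rewrite (gs _ _ _ c'c) (kt _ _ _ c'c) => /inc_inj.
have injJ := range_finite_inj finF FKJ.
have [sigma sh] := restrict_aut h nH; have [tau t1] := restrict_aut 1%g nH.
apply: contrapT => nv; apply: nHh.
suff st : sigma = tau.
  apply/cH/(@inc_inj _ _ A); rewrite -(sh _ _ _ c'c) st (t1 _ _ _ c'c).
  by rewrite tmap1.
apply: injJ; apply/funext => v; apply: (@inc_inj _ _ Fx).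
have [w wv wH] := fixed_tup v.
rewrite (sh _ _ _ (esym wv)) (t1 _ _ _ (esym wv)) tmap1; congr inc.
by apply: contrapT => hw; apply: nv; exists w.
Qed.

(** An automorphism of the fixed set is determined by its value on [c], which may have sorts
    unrelated to [J]; the hypothesis makes the [J]-tuples determine that value. *)
Lemma FK_intro J :
  (forall g h : G, (forall v : tup (sub A) J, (forall k : G, H k -> tmap k v = v) ->
     tmap g v = tmap h v) -> tmap g c = tmap h c) -> FK H J.
Proof.
move=> gh; apply: inj_card_eq => sigma tau _ _ E.
have [g gs] := lift_aut sigma; have [k kt] := lift_aut tau.
apply: (restricts_eq gs kt); apply: gh => w wH.
have [v vw] := tup_fixed wH.
apply: (@inc_inj _ _ A); rewrite -(gs _ _ _ vw) -(kt _ _ _ vw).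
by rewrite (congr1 (fun f => f v) E).
Qed.

End Stabilizer.

End Restriction.

(** * Conjugacy in the expansion by a predicate *)

Section Expansion.
Variables (L : lang) (N : structure L) (K : sset N).

Fixpoint lang_P_term G s (t : term (L := L) G s) : term (L := lang_P L) G s :=
  match t with
  | Var _ x => @Var (lang_P L) G _ x
  | App f ts => @App (lang_P L) G f (fun s x => lang_P_term (ts s x))
  end.

Fixpoint lang_P_formula G (phi : formula (L := L) G) : formula (L := lang_P L) G :=
  match phi with
  | Bot => Bot
  | Eq s t u => Eq (lang_P_term t) (lang_P_term u)
  | Rel R ts => @Rel (lang_P L) _ (inl R) (tmap (fun s t => lang_P_term t) ts)
  | Imp p q => Imp (lang_P_formula p) (lang_P_formula q)
  | All s p => @All (lang_P L) _ s (lang_P_formula p)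
  end.

Lemma eval_lang_P G s (t : term (L := L) G s) (v : tup N G) :
  @Defs.eval (lang_P L) (expandP K) G s (lang_P_term t) v = Defs.eval t v.
Proof.
elim: t => [s' x|f ts IH] //=.
congr (fint N f _); apply: eq_tget => s' x.
by rewrite !tget_ttab IH.
Qed.

Lemma sat_lang_P G (phi : formula (L := L) G) (v : tup N G) :
  sat (expandP K) (lang_P_formula phi) v <-> sat N phi v.
Proof.
elim: phi v => {G} [|G s t u|G R ts|G p IHp q IHq|G s p IHp] v /=.
- by [].
- by rewrite !eval_lang_P.
- rewrite tmap_comp.
  have -> : tmap (fun s t => @Defs.eval (lang_P L) (expandP K) G s (lang_P_term t) v) ts =
    tmap (fun s t => Defs.eval t v) ts by apply: eq_tmap => s t; exact: eval_lang_P.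
  by [].
- by rewrite IHp IHq.
- by split=> h a; apply/IHp; exact: h.
Qed.

Lemma udef_lang_P G (phi : formula (L := L) G) :
  udef (N := fun _ : unit => expandP K) (fun _ (v : tup N G) => sat N phi v).
Proof. by exists (lang_P_formula phi) => _ v; rewrite sat_lang_P. Qed.

Lemma udef_pred J : udef (N := fun _ : unit => expandP K)
  (fun _ (v : tup N J) => forall s (i : var J s), @K s (tget i v)).
Proof.
apply: (udef_all_var (N := fun _ : unit => expandP K)
  (Q := fun s i _ (v : tup N J) => @K s (tget i v))) => s i.
by exists (@Rel (lang_P L) _ (inr s) (@Var (lang_P L) J _ i, tt)) => _ v.
Qed.

End Expansion.

(** * Algebraic elements over [K] lie in [M] *)

Section ElementarySubstructure.
Variables (L : lang) (T : set (sentence L)) (C : structure L).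
Hypothesis C_models : models T C.
Variable K : sset C.
Arguments K : clear implicits.
Variable M : elementary_substructure C.
Hypothesis K_sub_M : forall s, K s `<=` esub_set M s.
Local Notation A := (@acl L C K).
Local Notation MM := (esub_structure M).

Definition incM J (v : tup MM J) : tup C J := @inc L C (esub_set M) J v.

Lemma incM_tcat J J' (u : tup MM J) (v : tup MM J') :
  incM (tcat u v) = tcat (incM u) (incM v).
Proof. exact: inc_tcat. Qed.

Lemma incM_inj J : injective (@incM J).
Proof. exact: inc_inj. Qed.

Lemma sat_MM J (phi : formula J) (v : tup MM J) : sat MM phi v <-> sat C phi (incM v).
Proof. exact: esub_elem. Qed.

Lemma MM_models : models T MM.
Proof. by move=> phi /C_models h; apply/sat_MM. Qed.

(** The solutions of [phi] in [M] are finitely many, listed by [y]. A solution outside [M] would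
    make [theta], the existence of a solution not in [y], true in the monster and hence in [M]. *)
Lemma acl_sub_M s (x : C s) : A x -> esub_set M s x.
Proof.
move=> [G0 [phi [b [phix finphi]]]].
have [bM bMb] : exists bM : tup MM G0, incM bM = inc b.
  by apply: tup_inc => s' i; apply: K_sub_M; exact: inc_in.
pose XM : set (tup MM [:: s]) := [set m | sat C phi ((sval m.1, inc b) : tup C (s :: G0))].
have [n [y yP]] : exists n (y : tup MM (pow n [:: s])), forall m, XM m -> tmem m y.
  have [[m0 Xm0]|X0] := pselect (exists m0, XM m0); last first.
    by exists 0%N, tt => m Xm; case: X0; exists m.
  have finX : finite_set XM.
    apply: card_le_finite finphi.
    suff [k] : $|{injfun XM >->
      [set x | sat C phi ((x, inc b) : tup C (s :: G0))]}| by exact: inj_card_le k.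
    apply/injfunPex; exists (fun m => sval m.1) => //.
    move=> [[m ?] []] [[m' ?] []] _ _ /= mm'; congr pair; exact: eq_exist.
  have [n Xn] : exists n, XM #<= `I_n by exact/finite_set_leP.
  have [f _ Xf] := bounded_pack Xm0 (card_bounded m0 Xn).
  by exists n, (pack n f) => m /Xf.
apply: contrapT => nMx.
have [theta thetaP] : udef (N := fun N : structure L => N)
    (fun N (w : tup N (pow n [:: s] ++ G0)) => exists t : tup N [:: s],
      sat N phi (tcat t (tsnd w)) /\ ~ tmem t (tfst w)).
  apply: (@udef_ex _ _ (fun N : structure L => N) [:: s] (pow n [:: s] ++ G0)
    (fun N t w => sat N phi (tcat t (tsnd w)) /\ ~ tmem t (tfst w))).
  have v0 := varmap_id (fun N : structure L => N) ([:: s] ++ pow n [:: s] ++ G0).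
  apply: udef_and.
    apply: udef_varmap (udef_formula _ phi) (varmap_tcat (varmap_tfst v0) _).
    exact: varmap_tsnd (varmap_tsnd v0).
  apply: udef_not.
  apply: (udef_varmap2 (R := fun _ u v => tmem u v)) (varmap_tfst v0) _.
    exact: udef_tmem.
  exact: varmap_tfst (varmap_tsnd v0).
have : sat C theta (incM (tcat y bM)).
  rewrite incM_tcat; apply/thetaP; exists (x, tt); rewrite tfstK tsndK; split.
    by rewrite bMb.
  move=> /tmem_tmap_inv[m _] /(congr1 fst) /= xm.
  by apply: nMx; rewrite xm; exact: svalP.
move/sat_MM/thetaP => [t]; rewrite tfstK tsndK => -[/sat_MM].
rewrite (incM_tcat t bM) bMb => tX; apply; exact: yP.
Qed.
End ElementarySubstructure.

Section Conjugacy.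
Variables (kappa : Type) (L : lang) (T : set (sentence L)) (C : structure L).
Hypotheses (T_uei : uniform_elimination_of_imaginaries T) (C_models : models T C)
  (C_monster : monster kappa C).
Variable K : sset C.
Hypotheses (K_small : small kappa K) (K_dcl : definably_closed K).
Arguments K : clear implicits.
Variable M : elementary_substructure C.
Hypothesis K_sub_M : forall s, K s `<=` esub_set M s.
Local Notation A := (@acl L C K).
Local Notation G := (galois_group K).
Local Notation MM := (esub_structure M).
Local Notation MP := (@expandP L MM (fun s (x : sub (esub_set M) s) => K s (sval x))).
Local Open Scope group_scope.

(** This is [g x = y] for tuples of [M]. It forces [x] and [y] to be algebraic over [K], so that
    [orb x] is empty for other [x]. *)
Definition moves (g : G) J (x y : tup MM J) : Prop :=
  exists u : tup (sub A) J, incM x = inc u /\ incM y = inc (tmap g u).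

Definition orb J (x : tup MM J) : set (tup MM J) := [set y | exists g, moves g x y].

Definition conj n J (x y : tup MM J) : Prop := orb x y /\ bounded n (orb x).

Lemma acl_incM J (u : tup (sub A) J) : exists x : tup MM J, incM x = inc u.
Proof.
apply: tup_inc => s i; apply: (acl_sub_M K_sub_M); exact: inc_in.
Qed.

Lemma moves_inc (g : G) J (x y : tup MM J) (u : tup (sub A) J) : incM x = inc u ->
  moves g x y <-> incM y = inc (tmap g u).
Proof.
move=> xu; split=> [[v [xv ->]]|yu]; last by exists u.
by move: xv; rewrite xu => /inc_inj ->.
Qed.

Lemma moves_fun (g : G) J (x y z : tup MM J) : moves g x y -> moves g x z -> y = z.
Proof.
move=> [u [xu yu]] /(moves_inc g _ xu) zu.
by apply: (@incM_inj _ _ M); rewrite yu zu.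
Qed.

Lemma moves_ex (g h : G) J (x y : tup MM J) : moves g x y -> exists z, moves h x z.
Proof.
move=> [u [xu _]]; have [z zu] := acl_incM (tmap h u).
by exists z; apply/(moves_inc _ _ xu).
Qed.

Lemma moves1 (g : G) J (x y : tup MM J) : moves g x y -> moves 1%g x x.
Proof. by move=> [u [xu _]]; exists u; rewrite tmap1. Qed.

Lemma movesM (g h : G) J (x y z : tup MM J) :
  moves h x y -> moves g y z -> moves (g * h)%g x z.
Proof.
move=> [u [xu yu]] [v [yv zv]]; exists u; split=> //.
by rewrite tmapM //; move: yu; rewrite yv zv => /inc_inj ->.
Qed.

Lemma movesV (g : G) J (x y : tup MM J) : moves g x y -> moves g^-1%g y x.
Proof.
by move=> [u [xu yu]]; exists (tmap g u); rewrite tmapVK.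
Qed.

Lemma moves_tcat (g : G) J J' (x y : tup MM J) (x' y' : tup MM J') :
  moves g (tcat x x') (tcat y y') <-> moves g x y /\ moves g x' y'.
Proof.
split=> [[u]|[[u [xu yu]] [u' [xu' yu']]]]; last first.
  by exists (tcat u u'); rewrite !incM_tcat tmap_tcat !inc_tcat xu yu xu' yu'.
rewrite !incM_tcat -[u]tcatK tmap_tcat !inc_tcat => -[xu yu].
split; [exists (tfst u)|exists (tsnd u)].
  split; [have := congr1 (@tfst _ C J J') xu|have := congr1 (@tfst _ C J J') yu];
    by rewrite !tfstK.
split; [have := congr1 (@tsnd _ C J J') xu|have := congr1 (@tsnd _ C J J') yu];
  by rewrite !tsndK.
Qed.

Section Coded.
Variables (n : nat) (J J' : seq (lsort L)) (chi : formula (pow n J ++ J')).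
Hypothesis chiP : forall N, models T N ->
  (forall z : tup N (pow n J), exists! c, sat N chi (tcat z c)) /\
  (forall z z' : tup N (pow n J), (forall x, tmem x z <-> tmem x z') <->
     exists2 c, sat N chi (tcat z c) & sat N chi (tcat z' c)).

Definition coded (z : tup MM (pow n J)) : Prop :=
  exists c : tup MM J', sat MM chi (tcat z c) /\
    forall s (i : var J' s), K s (sval (tget i c)).

(** The code is found in [M], where [chi] is functional too; by elementarity it is also the code in
    the monster, to which [code_in] applies. *)
Lemma coded_Kdef z : coded z <-> Kdef K [set x | tmem x (incM z)].
Proof.
have [chi_fun chi_eq] := chiP C_models.
have codeE c : sat MM chi (tcat z c) -> Kdef K [set x | tmem x (incM z)] <->
    forall s (i : var J' s), K s (sval (tget i c)).
  move=> /sat_MM; rewrite incM_tcat => /(code_in chi_fun chi_eq K_dcl) ->.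
  by split=> h s i; have := h s i; rewrite /incM /inc tget_tmap.
split=> [[c [/codeE ->]]//|dz].
have [c [zc _]] := (chiP (MM_models C_models M)).1 z.
by exists c; split=> //; apply/(codeE c zc).
Qed.

Lemma conj_coded (x y : tup MM J) : conj n x y <->
  (exists z, tmem x z /\ coded z) /\ (forall z, tmem x z -> coded z -> tmem y z).
Proof.
have memM (t : tup MM J) (z : tup MM (pow n J)) : tmem (incM t) (incM z) <-> tmem t z.
  by apply: tmem_tmap => s [a ?] [b ?] /= ab; exact: eq_exist.
have orbz (u : tup (sub A) J) (z : tup MM (pow n J)) (g : G) (t : tup MM J) :
    incM x = inc u -> incM t = inc (tmap g u) -> tmem x z -> coded z -> tmem t z.
  move=> xu tu xz /coded_Kdef dz; apply/memM.
  have := galois_Kdef K_dcl g u dz; rewrite -xu -tu /= !memM => <-; exact: xz.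
split=> [[[g [u [xu yu]]] bx]|[[z [xz zK]] allz]]; last first.
  have /coded_Kdef dz := zK.
  have finz : finite_set [set t : tup C J | tmem t (incM z)].
    by apply/finite_set_leP; exists n; apply/bounded_card/bounded_tmem/(incM x).
  have [u xu] := finite_Kdef_acl dz finz (iffRL (memM x z) xz).
  have bx : bounded n (orb x).
    (* A coded list containing [x] contains all conjugates of [x], hence bounds their number by
       [n]. *)
    have [f fz] := tmem_enum z x; exists f => t [g [v [xv tv]]].
    by have [i i_n <-] := fz t (orbz v z g t xv tv xz zK); exists i.
  split=> //.
  have [X [dX _ XP]] := orbit_Kdef C_monster K_small K_dcl u.
  have Xx : X (incM x) by apply/XP; exists 1%g; rewrite tmap1.
  have orbX t : orb x t <-> X (incM t).
    rewrite XP; split=> [[g /(moves_inc _ _ (esym xu))]|[g tu]]; exists g => //.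
    by apply/(moves_inc _ _ (esym xu)).
  have orbx : orb x x by apply/orbX.
  (* The list of exactly the orbit is coded, so the assumption on all coded lists applies to it and
     puts [y] in the orbit. *)
  have [f fO Of] := bounded_pack orbx bx.
  apply/Of/allz; first by apply/Of.
  apply/coded_Kdef; apply: Kdef_ext dX => t; split=> [/XP[g tu]|].
    have [tM tMt] := acl_incM (tmap g u).
    by rewrite /= tu -tMt memM -Of orbX tMt XP; exists g.
  by move=> /tmem_tmap_inv[m /Of /orbX Xm ->].
split=> [|z xz zK]; last exact: orbz xu yu xz zK.
have orbx : orb x x by exists 1%g, u; rewrite tmap1.
have [f fO Of] := bounded_pack orbx bx.
exists (pack n f); split; first by apply/Of.
have [X [dX _ XP]] := orbit_Kdef C_monster K_small K_dcl u.
apply/coded_Kdef; apply: Kdef_ext dX => t; split=> [/XP[h tu]|].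
  have [tM tMt] := acl_incM (tmap h u).
  rewrite /= tu -tMt memM -Of; exists h.
  by apply/(moves_inc _ _ xu).
move=> /tmem_tmap_inv[m /Of[h /(moves_inc _ _ xu) mu] ->].
by apply/XP; exists h.
Qed.

End Coded.

Lemma udef_conj n J : udef (N := fun _ : unit => MP)
  (fun _ (w : tup MM (J ++ J)) => conj n (tfst w) (tsnd w)).
Proof.
have [J' [chi chiP]] := set_code n J T_uei.
have dcoded : udef (N := fun _ : unit => MP) (fun _ (z : tup MM (pow n J)) => coded chi z).
  rewrite /coded.
  apply: (@udef_ex (lang_P L) unit (fun=> MP) J' (pow n J) (fun _ (c : tup MM J') z =>
    sat MM chi (tcat z c) /\ forall s (i : var J' s), K s (sval (tget i c)))).
  have v0 := varmap_id (fun _ : unit => MP) (J' ++ pow n J).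
  apply: udef_and.
    apply: (udef_varmap (udef_lang_P _ chi)); apply: varmap_tcat (varmap_tfst v0).
    exact: varmap_tsnd.
  exact: (udef_varmap (udef_pred _ J') (varmap_tfst v0)).
apply: (@udef_ext (lang_P L) unit (fun=> MP) (J ++ J) (fun _ (w : tup MM (J ++ J)) =>
  (exists z, tmem (tfst w) z /\ coded chi z) /\
  (forall z, tmem (tfst w) z -> coded chi z -> tmem (tsnd w) z))).
  by move=> _ w; rewrite (conj_coded chiP).
have v0 := varmap_id (fun _ : unit => MP) (pow n J ++ J ++ J).
have v1 := varmap_tfst v0; have v2 := varmap_tfst (varmap_tsnd v0).
have v3 := varmap_tsnd (varmap_tsnd v0).
have d1 := udef_varmap dcoded v1.
have d2 := udef_varmap2 (N := fun=> MP)
  (R := fun _ (u : tup MP J) (v : tup MP (pow n J)) => tmem u v)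
  (udef_tmem (fun _ : unit => MP) n J) v2 v1.
have d3 := udef_varmap2 (N := fun=> MP)
  (R := fun _ (u : tup MP J) (v : tup MP (pow n J)) => tmem u v)
  (udef_tmem (fun _ : unit => MP) n J) v3 v1.
apply: udef_and.
  apply: (@udef_ex (lang_P L) unit (fun=> MP) (pow n J) (J ++ J)
    (fun _ (z : tup MM (pow n J)) w => tmem (tfst w) z /\ coded chi z)).
  exact: udef_and.
apply: (@udef_all (lang_P L) unit (fun=> MP) (pow n J) (J ++ J)
  (fun _ (z : tup MM (pow n J)) w => tmem (tfst w) z -> coded chi z -> tmem (tsnd w) z)).
by apply: udef_imp d2 _; exact: udef_imp.
Qed.

End Conjugacy.

(** * Cosets and their representatives *)

Section Lcosets.
Variable G : groupType.
Local Open Scope group_scope.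
Implicit Types (H X : set G).

Lemma lcosetP g H h : lcoset g H h <-> H (g^-1 * h).
Proof.
by split=> [[x Hx <-]|Hgh]; [rewrite mulKg|exists (g^-1 * h); rewrite ?mulVKg].
Qed.

Lemma lcoset_eq g h H : normal_subgroup H -> lcoset g H h -> lcoset g H = lcoset h H.
Proof.
move=> [H1 HM HV _] /lcosetP Hgh; apply/seteqP; split=> x /lcosetP Hx; apply/lcosetP.
  by have := HM _ _ (HV _ Hgh) Hx; rewrite invgM invgK -mulgA mulVKg.
by have := HM _ _ Hgh Hx; rewrite -mulgA mulVKg.
Qed.

Lemma lcoset_refl g H : normal_subgroup H -> lcoset g H g.
Proof. by case=> H1 _ _ _; apply/lcosetP; rewrite mulVg. Qed.

Lemma lcoset_sub g g' H H' : normal_subgroup H -> normal_subgroup H' ->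
  lcoset g H `<=` lcoset g' H' -> H `<=` H'.
Proof.
move=> nH nH' sub h Hh.
have g'g := lcoset_eq nH' (sub _ (lcoset_refl g nH)).
have /sub : lcoset g H (g * h) by exists h.
by rewrite g'g => /lcosetP; rewrite mulKg.
Qed.

Lemma lcoset_inj g g' H H' : normal_subgroup H -> normal_subgroup H' ->
  lcoset g H = lcoset g' H' -> H = H'.
Proof.
move=> nH nH' E; apply/seteqP; split.
  by apply: (lcoset_sub (g := g) (g' := g') nH nH'); rewrite E.
by apply: (lcoset_sub (g := g') (g' := g) nH' nH); rewrite E.
Qed.

End Lcosets.

Section CosetRelations.
Variables (L : lang) (N : structure L) (K : sset N).
Local Notation G := (galois_group K).
Local Open Scope group_scope.
Variables (H H' H'' X X' X'' : set G) (g g' g'' : G).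
Hypotheses (oH : open_normal H) (oH' : open_normal H') (oH'' : open_normal H'').
Hypotheses (XE : X = lcoset g H) (XE' : X' = lcoset g' H') (XE'' : X'' = lcoset g'' H'').

Lemma coset_leP : coset_le X X' <-> H `<=` H'.
Proof.
split=> [[h [I [h' [I' [oI oI' E E' II']]]]]|HH']; last by exists g, H, g', H'.
rewrite XE in E; rewrite XE' in E'.
by rewrite (lcoset_inj oH.2 oI.2 E) (lcoset_inj oH'.2 oI'.2 E').
Qed.

(** An inclusion of cosets carries with it that of the subgroups, so [C] becomes plain inclusion of
    sets. *)
Lemma coset_CP : coset_C X X' <-> X `<=` X'.
Proof.
split=> [[h [I [h' [I' [oI oI' -> -> [II' <-]]]]]]|XX'].
  by move=> x /lcosetP Ix; apply/lcosetP; exact: II'.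
exists g, H, g', H'; split=> //; rewrite XE XE' in XX'.
split; first exact: (lcoset_sub oH.2 oH'.2 XX').
by apply/esym/lcoset_eq; [exact: oH'.2|apply/XX'/lcoset_refl; exact: oH.2].
Qed.

Lemma coset_PP : coset_P X X' X'' <-> [/\ H = H', H' = H'' &
  exists h h', [/\ X h, X' h' & X'' (h * h')]].
Proof.
rewrite XE XE' XE''; split.
  move=> [h [h' [h'' [I [oI E E' E'' hh]]]]].
  have EH := lcoset_inj oH.2 oI.2 E; have EH' := lcoset_inj oH'.2 oI.2 E'.
  have EH'' := lcoset_inj oH''.2 oI.2 E''.
  split; [by rewrite EH|by rewrite EH'|exists h, h'].
  by rewrite E E' E'' -hh; split; exact: lcoset_refl oI.2.
move=> [EH EH' [h [h' [hX hX' hX'']]]]; subst H' H''.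
exists h, h', (h * h'), H; split=> //; exact: lcoset_eq oH.2 _.
Qed.

End CosetRelations.

Section Representatives.
Variables (L : lang) (C : structure L) (K : sset C).
Arguments K : clear implicits.
Variable M : elementary_substructure C.
Hypothesis K_sub_M : forall s, K s `<=` esub_set M s.
Local Notation G := (galois_group K).
Local Notation MM := (esub_structure M).
Local Notation conj := (@conj L C K M).
Local Notation moves := (@moves L C K M).
Local Notation orb := (@orb L C K M).
Local Open Scope group_scope.

(** First-order substitute for: every [g] with [g x = y] has [g x' = y']. The tuple [t] runs over
    the values [g x'] for such [g]; [k] must bound the orbit of the concatenation, as in
    [sub_movesP]. *)
Definition sub_moves k J J' (x y : tup MM J) (x' y' : tup MM J') : Prop :=
  forall t, conj k (tcat x x') (tcat y t) -> t = y'.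

Lemma orb_moves (g : G) J (x y : tup MM J) : moves g x y -> orb x y.
Proof. by exists g. Qed.

Lemma bounded_tcat k k' J J' (x : tup MM J) (x' : tup MM J') :
  bounded k (orb x) -> bounded k' (orb x') -> bounded (k * k') (orb (tcat x x')).
Proof.
move=> bx bx'; have [f Of] := bounded_mul bx bx'; exists f => w [g gw]; apply: Of.
by move: gw; rewrite -{1}[w]tcatK => /moves_tcat[? ?]; split; exists g.
Qed.

Lemma bounded_orb k J (x y : tup MM J) : orb x y -> bounded k (orb x) -> bounded k (orb y).
Proof.
move=> [g gxy] [f Of]; exists f => z [h hyz]; apply: Of.
by exists (h * g); exact: movesM hyz.
Qed.

Lemma sub_movesP k k' J J' (x y z : tup MM J) (x' z' : tup MM J') y' :
  conj k x z -> conj k' x' z' ->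
  sub_moves (k * k') x y x' y' <-> forall g, moves g x y -> moves g x' y'.
Proof.
move=> [_ bx] [[h hx'] bx']; split=> [sxy g gxy|sxy t [[g /moves_tcat[gxy gx't]] _]].
  have [t gx't] := moves_ex K_sub_M g hx'.
  suff <- : t = y' by [].
  apply: sxy; split; last exact: bounded_tcat.
  by exists g; apply/moves_tcat.
exact: moves_fun gx't (sxy g gxy).
Qed.

(* A triple [(x, y, w)] stands for the coset of the [g] with [g x = y] if it is
   [valid], and for the trivial coset [G] otherwise.  The third component is there to
   have invalid triples: when [S_J(K)] is empty and [S_J(M)] is not, no valid triple
   might represent [G]. *)
Section Code.
Variables (k : nat) (J : seq (lsort L)).
Definition rep_src (a : tup MM (J ++ J ++ J)) : tup MM J := tfst a.
Definition rep_tgt (a : tup MM (J ++ J ++ J)) : tup MM J := tfst (tsnd a).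
Definition rep_flag (a : tup MM (J ++ J ++ J)) : tup MM J := tsnd (tsnd a).

(** The last clause is normality of the stabilizer of the source: that stabilizer fixes every
    conjugate of the source. *)
Definition valid (a : tup MM (J ++ J ++ J)) : Prop :=
  [/\ rep_flag a = rep_src a, conj k (rep_src a) (rep_tgt a) &
    forall y, orb (rep_src a) y -> forall g, moves g (rep_src a) (rep_src a) -> moves g y y].

Definition coset (a : tup MM (J ++ J ++ J)) : set G :=
  [set g | valid a -> moves g (rep_src a) (rep_tgt a)].

Definition base (a : tup MM (J ++ J ++ J)) : set G :=
  [set g | valid a -> moves g (rep_src a) (rep_src a)].

(** This expresses by conjugacy alone that [base a] is the whole group ([trivP]): either the triple
    is invalid or its source has no other conjugate. *)
Definition triv (a : tup MM (J ++ J ++ J)) : Prop :=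
  valid a -> forall t, conj k (rep_src a) t -> t = rep_src a.

Lemma valid_conj a : valid a -> conj k (rep_src a) (rep_tgt a).
Proof. by case. Qed.

Lemma base_normal a : normal_subgroup (base a).
Proof.
split=> [[_ [[g gxy] _] _]|g h gx hx va|g gx va|g h hx va].
- exact: moves1 gxy.
- exact: movesM (hx va) (gx va).
- exact: movesV (gx va).
- have [_ [[g0 xy] _] nor] := va.
  have [y gy] := moves_ex K_sub_M g^-1 xy.
  have := nor y (orb_moves gy) h (hx va) => hy.
  have := movesV gy; rewrite invgK => gyx.
  by have := movesM (movesM gy hy) gyx; rewrite mulgA.
Qed.

Lemma base_open_normal a : open_normal (base a).
Proof.
split; last exact: base_normal.
move=> g ga; have [va|nva] := pselect (valid a); last first.
  by exists set0 => [|h _ va]; [exact: finite_set0|].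
have [_ [[_ [u [xu _]]] _] _] := va.
exists [set y | exists i : var J (projT1 y), tget i u = projT2 y].
  exact: tget_finite.
move=> h hg _; apply/(moves_inc _ _ xu).
have /(moves_inc _ _ xu) -> := ga va; congr inc.
apply: eq_tget => s i; rewrite !tget_tmap.
by have -> := hg (existT _ s (tget i u)) (ex_intro _ i erefl).
Qed.

Lemma coset_lcoset a : exists g, coset a = lcoset g (base a).
Proof.
have [va|nva] := pselect (valid a); last first.
  exists 1; apply/seteqP; split=> h _; first by apply/lcosetP => va.
  by move=> va.
have [_ [[g gxy] _] _] := va; exists g; apply/seteqP; split=> h.
  by move=> /(_ va) hxy; apply/lcosetP => _; apply: movesM hxy (movesV gxy).
by move=> /lcosetP /(_ va) hx _; have := movesM hx gxy; rewrite mulVKg.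
Qed.

(** Cosets of a stabilizer correspond to points of the orbit; for an invalid triple the single coset
    [G] needs a place below [k], whence [0 < k]. *)
Lemma base_index a : (0 < k)%N -> index_le (base a) k.
Proof.
move=> k0; apply: bounded_card.
have [va|nva] := pselect (valid a); last first.
  exists (fun=> setT) => _ [g _ <-]; exists 0%N => //.
  by apply/seteqP; split=> h // _; apply/lcosetP => va.
have [_ [[g0 xy] [f Of]] _] := va.
exists (fun i => [set g | moves g (rep_src a) (f i)]) => _ [g _ <-].
have [z gz] := moves_ex K_sub_M g xy.
have [i i_k fi] := Of _ (orb_moves gz); exists i => //=.
rewrite fi; apply/seteqP; split=> h.
  by move=> hz; apply/lcosetP => _; exact: movesM hz (movesV gz).
by move=> /lcosetP/(_ va) hx; have := movesM hx gz; rewrite mulVKg.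
Qed.

Lemma coset_invalid a g : ~ valid a -> coset a g.
Proof. by move=> nva va. Qed.

Lemma trivP a : triv a <-> forall g, base a g.
Proof.
split=> [ta g va|ba va t [[g gxt] _]]; last exact: moves_fun gxt (ba g va).
have [_ [[h xy] bx] _] := va; have [t gt] := moves_ex K_sub_M g xy.
suff {2}<- : t = rep_src a by [].
by apply: ta => //; split=> //; exists g.
Qed.

Lemma triv_coset a g : triv a -> coset a g.
Proof.
move=> ta va; have bg := iffLR (trivP a) ta g va.
suff -> : rep_tgt a = rep_src a by [].
by apply: ta => //; exact: valid_conj.
Qed.

End Code.

Section Relations.
Variables (k k' : nat) (J J' : seq (lsort L)).
Variables (a : tup MM (J ++ J ++ J)) (a' : tup MM (J' ++ J' ++ J')).

Lemma base_sub : base k a `<=` base k' a' <-> triv k' a' \/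
  [/\ valid k a, valid k' a' &
    sub_moves (k * k') (rep_src a) (rep_src a) (rep_src a') (rep_src a')].
Proof.
split=> [bb|[ta'|[va va']] ]; last 2 first.
- by move=> g _; exact: (iffLR (trivP _ _) ta').
- move=> /(sub_movesP _ _ (valid_conj va) (valid_conj va')) h g ga _.
  by apply: h; exact: ga.
have [va'|nva'] := pselect (valid k' a'); last by left=> va'.
have [va|nva] := pselect (valid k a); last first.
  by left; apply/trivP => g; apply: bb => va.
right; split=> //.
apply/(sub_movesP _ _ (valid_conj va) (valid_conj va')) => g ga.
by apply: (bb g).
Qed.

Lemma coset_sub : coset k a `<=` coset k' a' <-> triv k' a' \/
  [/\ valid k a, valid k' a' &
    sub_moves (k * k') (rep_src a) (rep_tgt a) (rep_src a') (rep_tgt a')].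
Proof.
split=> [bb|[ta'|[va va']] ]; last 2 first.
- by move=> g _; exact: triv_coset.
- move=> /(sub_movesP _ _ (valid_conj va) (valid_conj va')) h g ga _.
  by apply: h; exact: ga.
have [va'|nva'] := pselect (valid k' a'); last by left=> va'.
have [va|nva] := pselect (valid k a); last first.
  (* Here the left coset is all of [G], hence so is the right one. Both [1] and [g] then send the
     source of [a'] to its target, so [g] fixes the source. *)
  have ca' g : coset k' a' g by apply: bb => va.
  left; apply/trivP => g _.
  by have := movesM (ca' g va') (movesV (ca' 1 va')); rewrite invg1 mul1g.
right; split=> //.
apply/(sub_movesP _ _ (valid_conj va) (valid_conj va')) => g ga.
by apply: (bb g).
Qed.

End Relations.

(** The witness [t] is [h] applied to the source of [c], so that [g t] being the target of [c] says
    that [g h] lies in its coset. One invalid triple makes all three bases equal to [G], which is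
    the first alternative. *)
Lemma coset_prod k J (a b c : tup MM (J ++ J ++ J)) :
  [/\ base k a = base k b, base k b = base k c &
    exists g h, [/\ coset k a g, coset k b h & coset k c (g * h)]] <->
  [/\ triv k a, triv k b & triv k c] \/
  [/\ valid k a, valid k b & valid k c] /\
    ([/\ base k a = base k b, base k b = base k c & exists t,
      conj (k * k) (tcat (rep_src b) (rep_src c)) (tcat (rep_tgt b) t) /\
      conj (k * k) (tcat (rep_src a) t) (tcat (rep_tgt a) (rep_tgt c))]).
Proof.
split=> [[ab bc [g [h [ag bh cgh]]]]|[[ta tb tc]|[[va vb vc]]]].
- have [va|nva] := pselect (valid k a); last first.
    have ta : triv k a by [].
    have tb : triv k b by apply/trivP; rewrite -ab; exact/trivP.
    have tc : triv k c by apply/trivP; rewrite -bc; exact/trivP.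
    by left.
  have [vb|nvb] := pselect (valid k b); last first.
    have tb : triv k b by [].
    have ta : triv k a by apply/trivP; rewrite ab; exact/trivP.
    have tc : triv k c by apply/trivP; rewrite -bc; exact/trivP.
    by left.
  have [vc|nvc] := pselect (valid k c); last first.
    have tc : triv k c by [].
    have tb : triv k b by apply/trivP; rewrite bc; exact/trivP.
    have ta : triv k a by apply/trivP; rewrite ab; exact/trivP.
    by left.
  right; split=> //; split=> //.
  have [_ [xya ba] _] := va; have [_ [xyb bb] _] := vb.
  have [_ [[g0 xyc] bc'] _] := vc.
  have [t ht] := moves_ex K_sub_M h xyc; exists t.
  split; split; try by apply: bounded_tcat => //; apply: bounded_orb bc'; exists h.
    by exists h; apply/moves_tcat; split=> //; exact: bh.
  exists g; apply/moves_tcat; split; first exact: ag.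
  by have := movesM (movesV ht) (cgh vc); rewrite -mulgA mulgV mulg1.
- have ba g : base k a g by exact: (iffLR (trivP _ _) ta).
  have bb g : base k b g by exact: (iffLR (trivP _ _) tb).
  have bc g : base k c g by exact: (iffLR (trivP _ _) tc).
  split; try by apply/seteqP; split.
  by exists 1, 1; split; exact: triv_coset.
- move=> [ab bc [t [[[h /moves_tcat[bh ht]] _] [[g /moves_tcat[ag gt]] _]]]].
  split=> //; exists g, h; split=> // _.
  exact: movesM ht gt.
Qed.

End Representatives.

(** * Triples over the right sorts decode onto each sort of the complete system *)

Section Sorts.
Variables (kappa : Type) (L : lang) (T : set (sentence L)) (C : structure L).
Hypotheses (T_uei : uniform_elimination_of_imaginaries T) (C_models : models T C)
  (C_monster : monster kappa C).
Variable K : sset C.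
Hypotheses (K_small : small kappa K) (K_dcl : definably_closed K).
Arguments K : clear implicits.
Variable M : elementary_substructure C.
Hypothesis K_sub_M : forall s, K s `<=` esub_set M s.
Local Notation A := (@acl L C K).
Local Notation G := (galois_group K).
Local Notation MM := (esub_structure M).
Local Notation moves := (@moves L C K M).
Local Notation coset := (@coset L C K M).
Local Notation base := (@base L C K M).
Local Notation valid := (@valid L C K M).
Local Open Scope group_scope.

Lemma agree_pow (H : set G) (g h : G) J n (u : tup (sub A) (pow n J)) :
  (forall v : tup (sub A) J, (forall k : G, H k -> tmap k v = v) -> tmap g v = tmap h v) ->
  (forall k : G, H k -> tmap k u = u) -> tmap g u = tmap h u.
Proof.
move=> gh; elim: n u => [|n IH] u Hu; first exact: tup_nil.
rewrite -[u]tcatK !tmap_tcat; congr tcat.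
  by apply: gh => k /Hu {2}<-; rewrite tmap_tfst.
by apply: IH => k /Hu {2}<-; rewrite tmap_tsnd.
Qed.

(** The source is a list of [J]-tuples fixed by the base, so agreement on fixed [J]-tuples gives
    agreement on the source, whose stabilizer is the base. An invalid triple has base [G], the
    stabilizer of the empty tuple. *)
Lemma FK_base k n J (a : tup MM (pow n J ++ pow n J ++ pow n J)) : FK (base k a) J.
Proof.
have [va|nva] := pselect (valid k a); last first.
  apply: (FK_intro C_monster K_small K_dcl (c := tt : tup (sub A) [::])) => [g|].
    by split=> // _ va.
  by [].
have [_ [[_ [u [xu _]]] _] _] := va.
have aE g : base k a g <-> tmap g u = u.
  split=> [/(_ va)|gu va']; last by apply/(moves_inc _ _ xu); rewrite gu.
  by move=> /(moves_inc _ _ xu); rewrite xu => /inc_inj.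
apply: (FK_intro C_monster K_small K_dcl aE) => g h gh.
by apply: (agree_pow gh) => k0 /aE.
Qed.

Lemma in_m_coset (m : gsort (lsort L)) n
    (a : tup MM (pow n m.2 ++ pow n m.2 ++ pow n m.2)) : in_m m (coset (sval m.1) a).
Proof.
have [g E] := coset_lcoset K (sval m.1) a.
exists g, (base (sval m.1) a); split=> //.
- exact: base_open_normal.
- exact: (base_index K_sub_M _ (svalP m.1)).
- exact: FK_base.
Qed.

(* If [S_J(M)] is empty, then [m(k, J)] has the trivial coset as its only element,
   which is represented by the empty triple. *)
Definition rep_mult (m : gsort (lsort L)) : nat :=
  if pselect (exists x : tup MM (pow (sval m.1) m.2), True) then sval m.1 else 0.

Definition rep_tup (m : gsort (lsort L)) : seq (lsort L) := pow (rep_mult m) m.2.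

Definition rep_ar (m : gsort (lsort L)) : seq (lsort L) := rep_tup m ++ rep_tup m ++ rep_tup m.

Definition decode (m : gsort (lsort L)) (a : tup MM (rep_ar m)) : set G :=
  coset (sval m.1)
    (a : tup MM (rep_tup m ++ rep_tup m ++ rep_tup m)).

(** If [(x, x, x)] does not already give [G], some [g] moves [x] to another [y], and the flag [y]
    makes [(x, x, y)] invalid. *)
Lemma decode_setT m : exists a : tup MM (rep_ar m), decode a = setT.
Proof.
have [x xP] : exists x : tup MM (rep_tup m), True.
  rewrite /rep_tup /rep_mult; case: pselect => [e|_] /=; last by exists tt.
  by have [x _] := e; exists x.
pose c w : tup MM (rep_ar m) := tcat x (tcat x w).
have [ct|cT] := pselect (forall g, decode (c x) g).
  by exists (c x); apply/seteqP; split=> // g _; exact: ct.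
have [g ng] : exists g, ~ decode (c x) g.
  by apply: contrapT => h; apply: cT => g; apply: contrapT => ng; apply: h; exists g.
have va : valid (sval m.1) (c x : tup MM (rep_tup m ++ rep_tup m ++ rep_tup m)).
  by apply: contrapT => nva; apply: ng; exact: coset_invalid.
have gx : ~ moves g x x.
  by move=> gx; apply: ng => _; rewrite /rep_src /rep_tgt /c !tsndK !tfstK.
have [_ [[h]]] := va; rewrite /rep_src /rep_tgt /c !tsndK !tfstK => hxx _ _.
have [y gy] := moves_ex K_sub_M g hxx.
exists (c y); apply/seteqP; split=> // k _ [].
rewrite /rep_src /rep_flag /c !tsndK !tfstK => yx; by rewrite yx in gy.
Qed.

(** The case [H = G] is split off because a [J]-tuple fixed by [H] need not exist there; a proper
    [H] gets one from [FK_elim]. *)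
Lemma decode_surj (m : gsort (lsort L)) (X : set G) : in_m m X ->
  exists a : tup MM (rep_ar m), decode a = X.
Proof.
move=> [g [H [oH iH fH ->]]].
have [HT|nHT] := pselect (forall h, H h).
  have [a aT] := decode_setT m; exists a; rewrite aT; apply/seteqP; split=> h _ //.
  by apply/lcosetP.
have [h0 nh0] : exists h, ~ H h.
  by apply: contrapT => h; apply: nHT => k; apply: contrapT => nk; apply: h; exists k.
have [Jc [c cH]] := stabilizer_code T_uei C_models C_monster K_small K_dcl oH.
have FKe h := FK_elim C_monster K_small K_dcl cH (h := h) oH.2 fH.
have [v0 [v0H _]] := FKe h0 nh0.
pose k := sval m.1; pose J := m.2.
have [e eP] : bounded k (range (fun g => lcoset g H)).
  exact: (card_bounded setT iH).
(* One tuple serves a whole coset [h H], because it is fixed by [H]; [v0] fills the indices that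
   list no coset other than [H]. *)
have /choice[v vP] : forall i, exists v : tup (sub A) J,
    (forall g : G, H g -> tmap g v = v) /\
    (forall h, lcoset h H = e i -> ~ H h -> tmap h v <> v).
  move=> i; have [[h [he nh]]|nex] := pselect (exists h, lcoset h H = e i /\ ~ H h).
    have [v [vH hv]] := FKe h nh; exists v; split=> // h' h'e nh' h'v.
    have : lcoset h H h' by rewrite he -h'e; exact: lcoset_refl oH.2.
    move=> /lcosetP /vH; rewrite tmapM // h'v => E.
    by apply: hv; rewrite -[in LHS]E tmapKV.
  by exists v0; split=> // h he nh; case: nex; exists h.
pose u := pack k v.
have uH h : H h <-> tmap h u = u.
  split=> [Hh|hu].
    rewrite /u tmap_pack; congr pack; apply/funext => i.
    by have [vH _] := vP i; exact: vH.
  apply: contrapT => nh; have [i /= i_k ei] := eP _ (ex_intro2 _ _ h I erefl).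
  have [_ /(_ h (esym ei) nh)] := vP i; apply.
  have aux n (f f' : nat -> tup (sub A) J) j : pack n f = pack n f' -> (j < n)%N -> f j = f' j.
    elim: n f f' j => [|n IH] f f' [|j] //= E jn.
      by have := congr1 (@tfst _ (sub A) J (pow n J)) E; rewrite !tfstK.
    have := congr1 (@tsnd _ (sub A) J (pow n J)) E; rewrite !tsndK.
    by move=> /(IH (fun i => f i.+1) (fun i => f' i.+1)); apply.
  by move: hu; rewrite /u tmap_pack => E; exact: aux E i_k.
(* The tuple [u], which lies in [M], shows that the degenerate value [0] of [rep_mult] does not
   occur here. *)
have rep_tupE : rep_tup m = pow k J.
  rewrite /rep_tup /rep_mult; case: pselect => // nex; case: nex.
  by have [x _] := acl_incM K_sub_M u; exists x.
have : exists a : tup MM (pow k J ++ pow k J ++ pow k J), coset k a = lcoset g H.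
  have [x xu] := acl_incM K_sub_M u.
  have [y yu] := acl_incM K_sub_M (tmap g u).
  have gxy : moves g x y by exists u.
  exists (tcat x (tcat y x)).
  have HE h : H h <-> moves h x x.
    by rewrite uH (moves_inc _ _ xu) xu; split=> [->|/inc_inj].
  have va : valid k (tcat x (tcat y x)).
    rewrite /valid /rep_src /rep_tgt /rep_flag !tsndK !tfstK; split=> //.
      split; first by exists g.
      (* The value [h x] depends only on the coset of [h], so the list [e] of at most [k] cosets
         yields a list of the orbit of [x]. *)
      pose f i := if pselect (exists z, exists2 h, lcoset h H = e i & moves h x z) is left E
        then sval (cid E) else x.
      exists f => z [h hz].
      have [i i_k ei] := eP _ (ex_intro2 _ _ h I erefl); exists i => //.
      rewrite /f; case: pselect => [E|[]]; last by exists z, h.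
      case: (cid E) => z' /= [h' h'e h'z'].
      have : lcoset h' H h by rewrite h'e ei; exact: lcoset_refl oH.2.
      move=> /lcosetP /HE hx; apply: moves_fun h'z' _.
      by have := movesM (movesV hx) hz; rewrite invgM invgK mulVKg.
    move=> z [h hz] h' /HE Hh'.
    have [_ _ _ HJ] := oH.2.
    have /HE := HJ h^-1 h' Hh'; rewrite invgK => hx.
    have := movesM (movesM (movesV hz) hx) hz.
    by rewrite !mulgA mulgV mul1g -mulgA mulgV mulg1.
  apply/seteqP; split=> h.
    move=> /(_ va); rewrite /rep_src /rep_tgt !tsndK !tfstK => hxy.
    by apply/lcosetP/HE; exact: movesM hxy (movesV gxy).
  move=> /lcosetP /HE hx _; rewrite /rep_src /rep_tgt !tsndK !tfstK.
  by have := movesM hx gxy; rewrite mulVKg.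
by rewrite /decode /rep_ar rep_tupE.
Qed.

End Sorts.

(** * Definability of the decoding in the expansion, and the interpretation *)

Section Interpretation.
Variables (kappa : Type) (L : lang) (T : set (sentence L)) (C : structure L).
Hypotheses (T_uei : uniform_elimination_of_imaginaries T) (C_models : models T C)
  (C_monster : monster kappa C).
Variable K : sset C.
Hypotheses (K_small : small kappa K) (K_dcl : definably_closed K).
Arguments K : clear implicits.
Variable M : elementary_substructure C.
Hypothesis K_sub_M : forall s, K s `<=` esub_set M s.
Local Notation G := (galois_group K).
Local Notation MM := (esub_structure M).
Local Notation MP := (@expandP L MM (fun s (x : sub (esub_set M) s) => K s (sval x))).
Local Notation conj := (@conj L C K M).
Local Notation coset := (@coset L C K M).
Local Notation base := (@base L C K M).
Local Notation valid := (@valid L C K M).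
Local Notation triv := (@triv L C K M).
Local Notation sub_moves := (@sub_moves L C K M).
Local Notation udefP X := (udef (N := fun _ : unit => MP) (fun _ => X)).
Local Notation varmapP p := (varmap (N := fun _ : unit => MP) (fun _ => p)).
Implicit Types (J : seq (lsort L)).

Lemma udefP_conj n J G0 (p q : tup MP G0 -> tup MP J) : varmapP p -> varmapP q ->
  udefP (fun v => conj n (p v) (q v)).
Proof.
move=> vp vq; apply: (@udef_varmap2 (lang_P L) unit (fun=> MP) J J
  (fun _ u v => conj n u v) G0 (fun=> p) (fun=> q)) => //.
exact: (udef_conj T_uei C_models C_monster K_small K_dcl K_sub_M).
Qed.

Lemma udefP_eq J G0 (p q : tup MP G0 -> tup MP J) : varmapP p -> varmapP q ->
  udefP (fun v => p v = q v).
Proof.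
move=> vp vq; apply: (@udef_varmap2 (lang_P L) unit (fun=> MP) J J
  (fun _ u v => u = v) G0 (fun=> p) (fun=> q)) => //.
exact: udef_eq.
Qed.

Lemma udefP_all J G0 (Q : tup MP J -> tup MP G0 -> Prop) :
  udefP (fun w : tup MP (J ++ G0) => Q (tfst w) (tsnd w)) ->
  udefP (fun v => forall t, Q t v).
Proof. exact: (@udef_all (lang_P L) unit (fun=> MP) J G0 (fun=> Q)). Qed.

Lemma udefP_ex J G0 (Q : tup MP J -> tup MP G0 -> Prop) :
  udefP (fun w : tup MP (J ++ G0) => Q (tfst w) (tsnd w)) ->
  udefP (fun v => exists t, Q t v).
Proof. exact: (@udef_ex (lang_P L) unit (fun=> MP) J G0 (fun=> Q)). Qed.

Lemma varmapP_tsnd J G0 J' (p : tup MP G0 -> tup MP J') : varmapP p ->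
  varmapP (fun w : tup MP (J ++ G0) => p (tsnd w)).
Proof.
move=> vp; apply: (@varmap_comp (lang_P L) unit (fun=> MP) _ _ _ (fun=> p)) => //.
exact/varmap_tsnd/varmap_id.
Qed.

Lemma udefP_sub_moves n J J' G0 (p q : tup MP G0 -> tup MP J)
    (p' q' : tup MP G0 -> tup MP J') :
  varmapP p -> varmapP q -> varmapP p' -> varmapP q' ->
  udefP (fun v => sub_moves n (p v) (q v) (p' v) (q' v)).
Proof.
move=> vp vq vp' vq'.
apply: (@udefP_all J' G0 (fun t v =>
  conj n (tcat (p v) (p' v)) (tcat (q v) t) -> t = q' v)).
have v0 := varmap_tfst (varmap_id (fun _ : unit => MP) (J' ++ G0)).
have wp := varmapP_tsnd J' vp; have wq := varmapP_tsnd J' vq.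
have wp' := varmapP_tsnd J' vp'; have wq' := varmapP_tsnd J' vq'.
apply: udef_imp; last exact: udefP_eq v0 wq'.
by apply: (udefP_conj (J := J ++ J') n); [exact: varmap_tcat wp wp'|
  exact: varmap_tcat wq v0].
Qed.

Section OneCode.
Variables (k : nat) (J G0 : seq (lsort L)) (p : tup MP G0 -> tup MP (J ++ J ++ J)).
Hypothesis vp : varmapP p.

Lemma varmapP_src : varmapP (fun v => rep_src (p v)).
Proof. exact: varmap_tfst vp. Qed.

Lemma varmapP_tgt : varmapP (fun v => rep_tgt (p v)).
Proof. exact: varmap_tfst (varmap_tsnd vp). Qed.

Lemma varmapP_flag : varmapP (fun v => rep_flag (p v)).
Proof. exact: varmap_tsnd (varmap_tsnd vp). Qed.

Lemma udefP_triv : udefP (fun v => valid k (p v)) -> udefP (fun v => triv k (p v)).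
Proof.
move=> dv; apply: udef_imp dv _.
apply: (@udefP_all J G0 (fun t v => conj k (rep_src (p v)) t -> t = rep_src (p v))).
have v0 := varmap_tfst (varmap_id (fun _ : unit => MP) (J ++ G0)).
have v1 := varmapP_tsnd J varmapP_src.
by apply: udef_imp; [exact: udefP_conj|exact: udefP_eq].
Qed.

(** The quantifier over [g] in the normality clause is removed by [sub_moves]; the bound is [k * k]
    because [y], being conjugate to the source, has the same orbit. *)
Lemma udefP_valid : udefP (fun v => valid k (p v)).
Proof.
have : udefP (fun v => (rep_flag (p v) = rep_src (p v) /\ conj k (rep_src (p v)) (rep_tgt (p v))) /\
    forall y, conj k (rep_src (p v)) y ->
      sub_moves (k * k) (rep_src (p v)) (rep_src (p v)) y y).
  apply: udef_and.
    apply: udef_and; first exact: udefP_eq varmapP_flag varmapP_src.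
    exact: udefP_conj varmapP_src varmapP_tgt.
  apply: (@udefP_all J G0 (fun y v => conj k (rep_src (p v)) y ->
      sub_moves (k * k) (rep_src (p v)) (rep_src (p v)) y y)).
  have v0 := varmap_tfst (varmap_id (fun _ : unit => MP) (J ++ G0)).
  have v1 := varmapP_tsnd J varmapP_src.
  by apply: udef_imp; [exact: udefP_conj|exact: udefP_sub_moves].
apply: udef_ext => _ v; split=> [[[wx cxy] nor]|[wx cxy nor]].
  split=> // y xy g gx; have [_ bx] := cxy.
  have cxy' : conj k (rep_src (p v)) y by [].
  have cyy : conj k y (rep_src (p v)).
    split; last exact: bounded_orb bx.
    by have [h hxy] := xy; exists (h^-1)%g; exact: movesV.
  by have /(sub_movesP K_sub_M _ _ cxy cyy) := nor y cxy'; apply.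
split=> // y cxy'; have [xy bx] := cxy'.
have cyy : conj k y (rep_src (p v)).
  split; last exact: bounded_orb bx.
  by have [h hxy] := xy; exists (h^-1)%g; exact: movesV.
by apply/(sub_movesP K_sub_M _ _ cxy cyy); exact: nor.
Qed.

End OneCode.

Section TwoCodes.
Variables (k k' : nat) (J J' G0 : seq (lsort L)).
Variables (p : tup MP G0 -> tup MP (J ++ J ++ J)) (p' : tup MP G0 -> tup MP (J' ++ J' ++ J')).
Hypotheses (vp : varmapP p) (vp' : varmapP p').

Lemma udefP_base_sub : udefP (fun v => base k (p v) `<=` base k' (p' v)).
Proof.
apply: (@udef_ext (lang_P L) unit (fun=> MP) _ (fun _ v => triv k' (p' v) \/
  (valid k (p v) /\ valid k' (p' v)) /\
   sub_moves (k * k') (rep_src (p v)) (rep_src (p v)) (rep_src (p' v)) (rep_src (p' v)))).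
  move=> _ v; rewrite (base_sub K_sub_M).
  by split=> [[ta|[[va va'] s]]|[ta|[va va' s]]]; [left|right|left|right].
have dv := udefP_valid k vp; have dv' := udefP_valid k' vp'.
apply: udef_or; first exact: udefP_triv.
apply: udef_and; first exact: udef_and.
by apply: udefP_sub_moves; exact: varmapP_src.
Qed.

Lemma udefP_coset_sub : udefP (fun v => coset k (p v) `<=` coset k' (p' v)).
Proof.
apply: (@udef_ext (lang_P L) unit (fun=> MP) _ (fun _ v => triv k' (p' v) \/
  (valid k (p v) /\ valid k' (p' v)) /\
   sub_moves (k * k') (rep_src (p v)) (rep_tgt (p v)) (rep_src (p' v)) (rep_tgt (p' v)))).
  move=> _ v; rewrite (coset_sub K_sub_M).
  by split=> [[ta|[[va va'] s]]|[ta|[va va' s]]]; [left|right|left|right].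
have dv := udefP_valid k vp; have dv' := udefP_valid k' vp'.
apply: udef_or; first exact: udefP_triv.
apply: udef_and; first exact: udef_and.
by apply: udefP_sub_moves; (exact: varmapP_src || exact: varmapP_tgt).
Qed.

End TwoCodes.

Lemma udefP_coset_prod k J G0 (p q r : tup MP G0 -> tup MP (J ++ J ++ J)) :
  varmapP p -> varmapP q -> varmapP r ->
  udefP (fun v => [/\ base k (p v) = base k (q v), base k (q v) = base k (r v) &
    exists g h, [/\ coset k (p v) g, coset k (q v) h & coset k (r v) (g * h)%g]]).
Proof.
move=> vp vq vr.
apply: (@udef_ext (lang_P L) unit (fun=> MP) _ (fun _ v =>
  (triv k (p v) /\ triv k (q v) /\ triv k (r v)) \/
  (valid k (p v) /\ valid k (q v) /\ valid k (r v)) /\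
  ((base k (p v) `<=` base k (q v) /\ base k (q v) `<=` base k (p v)) /\
   (base k (q v) `<=` base k (r v) /\ base k (r v) `<=` base k (q v))) /\
  exists t, conj (k * k) (tcat (rep_src (q v)) (rep_src (r v))) (tcat (rep_tgt (q v)) t) /\
      conj (k * k) (tcat (rep_src (p v)) t) (tcat (rep_tgt (p v)) (rep_tgt (r v))))).
  move=> _ v; rewrite (coset_prod K_sub_M); split.
    case=> [[? []]|[[? [? ?]] [[[? ?] [? ?]] ?]]]; first by left.
    by right; split=> //; split=> //; apply/seteqP.
  case=> [[? ? ?]|[[? ? ?] [-> -> ?]]]; first by left.
  by right; split=> //; split=> //; split; split.
have dv := udefP_valid k vp; have dq := udefP_valid k vq; have dr := udefP_valid k vr.
apply: udef_or.
  by apply: udef_and; [|apply: udef_and]; exact: udefP_triv.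
apply: udef_and; first by apply: udef_and => //; exact: udef_and.
apply: udef_and; first by apply: udef_and; apply: udef_and; exact: udefP_base_sub.
apply: (@udefP_ex J G0 (fun t v =>
  conj (k * k) (tcat (rep_src (q v)) (rep_src (r v))) (tcat (rep_tgt (q v)) t) /\
  conj (k * k) (tcat (rep_src (p v)) t) (tcat (rep_tgt (p v)) (rep_tgt (r v))))).
have v0 := varmap_tfst (varmap_id (fun _ : unit => MP) (J ++ G0)).
have xp := varmapP_tsnd J (varmapP_src vp); have yp := varmapP_tsnd J (varmapP_tgt vp).
have xq := varmapP_tsnd J (varmapP_src vq); have yq := varmapP_tsnd J (varmapP_tgt vq).
have xr := varmapP_tsnd J (varmapP_src vr); have yr := varmapP_tsnd J (varmapP_tgt vr).
apply: udef_and; apply: (udefP_conj (J := J ++ J) _).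
- exact: varmap_tcat xq xr.
- exact: varmap_tcat yq v0.
- exact: varmap_tcat xp v0.
- exact: varmap_tcat yp yr.
Qed.

(** An element is sent to the set of all triples decoding to it, which is one class of the
    equivalence relation of the interpretation. *)
Let code_map (m : gsort (lsort L)) (X : {X : set G | in_m m X}) : set (tup MP (rep_ar M m)) :=
  [set a | decode (K := K) a = sval X].

Lemma code_map_bij m : set_bij [set: {X : set G | in_m m X}]
  [set [set b | decode (K := K) a = decode b] | a in [set: tup MP (rep_ar M m)]]
  (@code_map m).
Proof.
split=> [X _|X Y _ _ XY|_ [a _ <-]].
- have [a aX] := decode_surj T_uei C_models C_monster K_small K_dcl K_sub_M (svalP X).
  by exists a => //; rewrite aX; apply/seteqP; split=> b /= /esym.
- have [a aX] := decode_surj T_uei C_models C_monster K_small K_dcl K_sub_M (svalP X).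
  have : code_map X a by [].
  rewrite XY => aY; case: X Y {XY} aX aY => X mX [Y mY] /= aX aY.
  by apply: eq_exist; rewrite -aX; exact: aY.
- exists (exist _ (decode a) (in_m_coset C_monster K_small K_dcl K_sub_M (m := m) a)) => //.
  by apply/seteqP; split=> b /= /esym.
Qed.

Lemma code_rel_def (R : lrel (lang_G (lsort L))) :
  exists phi : formula (L := lang_P L) (flatten (map (rep_ar M) (rel_ar R))),
    forall (n : tup (sorted_complete_system K) (rel_ar R))
      (a : tup (fun m => tup MP (rep_ar M m)) (rel_ar R)),
      tall2 (fun m X b => code_map X b) n a ->
      (rint (sorted_complete_system K) R n <-> sat MP phi (tflatten a)).
Proof.
have oB k J (a : tup MM (J ++ J ++ J)) : open_normal (base k a).
  exact: base_open_normal.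
case: R => [m m'|m m'|m] /=.
(* The trailing [[::]] is what [flatten] leaves at the end of the list of arguments. *)
- have v0 := varmap_id (fun _ : unit => MP) (rep_ar M m ++ rep_ar M m' ++ [::]).
  have [phi phiP] := udefP_base_sub (sval m.1) (sval m'.1) (varmap_tfst v0)
    (varmap_tfst (varmap_tsnd v0)).
  exists phi => -[X [X' []]] [a [a' []]] [Xa [Xa' _]].
  apply: iff_trans (phiP tt _); rewrite /= tsndK !tfstK -Xa -Xa'.
  have [g E] := coset_lcoset K (sval m.1)
    (a : tup MM (rep_tup M m ++ rep_tup M m ++ rep_tup M m)).
  have [g' E'] := coset_lcoset K (sval m'.1)
    (a' : tup MM (rep_tup M m' ++ rep_tup M m' ++ rep_tup M m')).
  exact: coset_leP (oB _ _ _) (oB _ _ _) E E'.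
- have v0 := varmap_id (fun _ : unit => MP) (rep_ar M m ++ rep_ar M m' ++ [::]).
  have [phi phiP] := udefP_coset_sub (sval m.1) (sval m'.1) (varmap_tfst v0)
    (varmap_tfst (varmap_tsnd v0)).
  exists phi => -[X [X' []]] [a [a' []]] [Xa [Xa' _]].
  apply: iff_trans (phiP tt _); rewrite /= tsndK !tfstK -Xa -Xa'.
  have [g E] := coset_lcoset K (sval m.1)
    (a : tup MM (rep_tup M m ++ rep_tup M m ++ rep_tup M m)).
  have [g' E'] := coset_lcoset K (sval m'.1)
    (a' : tup MM (rep_tup M m' ++ rep_tup M m' ++ rep_tup M m')).
  exact: coset_CP (oB _ _ _) (oB _ _ _) E E'.
- have v0 := varmap_id (fun _ : unit => MP) (rep_ar M m ++ rep_ar M m ++ rep_ar M m ++ [::]).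
  have [phi phiP] := udefP_coset_prod (sval m.1) (varmap_tfst v0)
    (varmap_tfst (varmap_tsnd v0)) (varmap_tfst (varmap_tsnd (varmap_tsnd v0))).
  exists phi => -[X [X' [X'' []]]] [a [a' [a'' []]]] [Xa [Xa' [Xa'' _]]].
  apply: iff_trans (phiP tt _); rewrite /= !tsndK !tfstK -Xa -Xa' -Xa''.
  have [g E] := coset_lcoset K (sval m.1)
    (a : tup MM (rep_tup M m ++ rep_tup M m ++ rep_tup M m)).
  have [g' E'] := coset_lcoset K (sval m.1)
    (a' : tup MM (rep_tup M m ++ rep_tup M m ++ rep_tup M m)).
  have [g'' E''] := coset_lcoset K (sval m.1)
    (a'' : tup MM (rep_tup M m ++ rep_tup M m ++ rep_tup M m)).
  exact: coset_PP (oB _ _ _) (oB _ _ _) (oB _ _ _) E E' E''.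
Qed.

(** The domain of each sort is everything: decoding is total, invalid triples giving [G], and every
    value lies in the sort by [in_m_coset]. Equality of cosets is defined as two inclusions. *)
Lemma decode_interpretation : interpretation (sorted_complete_system K) MP.
Proof.
refine (@Build_interpretation (lang_G (lsort L)) (sorted_complete_system K)
  (lang_P L) MP (rep_ar M) (fun m => setT)
  (fun m a b => decode (K := K) a = decode b) code_map _ _ _ _ _ _).
- by move=> m; split=> [a|a b|a b c] //= -> .
- by move=> m; exists (Imp Bot Bot) => a; split=> // _.
- move=> m.
  have v0 := varmap_id (fun _ : unit => MP) (rep_ar M m ++ rep_ar M m).
  have v1 := varmap_tfst v0; have v2 := varmap_tsnd v0.
  have [phi phiP] := udef_and (udefP_coset_sub (sval m.1) (sval m.1) v1 v2)
    (udefP_coset_sub (sval m.1) (sval m.1) v2 v1).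
  exists phi => a b; apply: iff_trans (phiP tt _); rewrite /= tsndK !tfstK.
  by split=> [E|[? ?]]; [rewrite /decode in E; split; rewrite E|apply/seteqP].
- exact: code_map_bij.
- exact: code_rel_def.
- by [].
Qed.

End Interpretation.

Theorem theorem3p26 (L : lang) (T : set (sentence L))
    (T_complete : complete_theory T)
    (T_qe : quantifier_elimination T)
    (T_uei : uniform_elimination_of_imaginaries T)
    (kappa : Type) (C : structure L)
    (C_models : models T C) (C_monster : monster kappa C)
    (K : sset C) (K_small : small kappa K) (K_dcl : definably_closed K)
    (M : elementary_substructure C) (K_sub_M : forall s, K s `<=` esub_set M s) :
  interpretable (sorted_complete_system K)
    (@expandP L (esub_structure M)
       (fun s (x : sub (esub_set M) s) => K s (sval x))).
Proof.
constructor.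
exact: (decode_interpretation T_uei C_models C_monster K_small K_dcl K_sub_M).
Qed.
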